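(* Let $p$ be a prime, let $G$ be a finite $p$-group, and let $n$ be a non-negative integer such that $|G'| > p^{n(n-1)/2}$. Then there do not exist $p-1$ proper subgroups $H_1, \dots, H_{p-1}$ of $G$ such that every element $x \in G$ with $b(x) \geq n$ lies in $H_1 \cup \dots \cup H_{p-1}$.
   Context: $G'$ denotes the derived subgroup of $G$. For $x$ in a finite $p$-group $G$, the breadth $b(x)$ is defined by $|G : C_G(x)| = p^{b(x)}$, where $C_G(x)$ is the centralizer of $x$ in $G$. *)

(* Defs.v *)
From mathcomp Require Import all_boot all_fingroup all_solvable.
From mathcomp Require Import pgroup commutator.
Set Implicit Arguments. Unset Strict Implicit. Unset Printing Implicit Defensive.

Definition breadth (p : nat) (gT : finGroupType) (G : {set gT}) (x : gT) : nat :=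
  logn p #|G : 'C_G[x]|%g.

(* Main.v *)
Require Import Defs.
From mathcomp Require Import all_boot all_fingroup all_solvable.
From mathcomp Require Import pgroup commutator.
From mathcomp Require Import zify.
Set Implicit Arguments. Unset Strict Implicit. Unset Printing Implicit Defensive.

(** Let [m = n - 1] and suppose that all elements off the subgroups [H i] have
    breadth at most [m].  We bound [logn p #|G^`(1)|] by ['C(m.+1, 2)].

    Work in the graded Lie ring of the lower central series.  Adjoining a "letter"
    [x], i.e. dividing by the image of [ad x], costs at most [m] and lowers by one
    the breadth of every element [y] whose image meets that of [x]; since the new
    breadth of [y] and [y * x ^+ k] agree, the elements where this fails lie in one
    proper subgroup and one can iterate.  For odd [p] this gives [m + ... + 1].
    For [p = 2] the iteration can get stuck on nondegenerate symmetric forms and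
    only gives [m + ... + 1 + 1].

    If [p = 2] and this weaker bound is attained, then every element off [H] that is
    noncentral modulo the third term has breadth exactly [m] already in the graded
    ring, and comparing [z] with [z * y] for [y] in the derived subgroup shows that
    whatever centralizes [z] modulo the third term sends [y] into the image of
    [ad z].  Choosing [z_0, z_1, ...] greedily until these centralizers generate
    [G], the third term is spanned by the images of the [ad z_i], and adding up the
    dimensions gives ['C(m.+1, 2)] after all. *)

(** * Commutator calculus in the lower central series *)

Section ThreeSubgroups.
Import GroupScope.

(** The three subgroups lemma in [G / T]; [aux] turns inclusion in [T] into triviality of the image
    commutator. *)
Lemma three_subgroup_mod (gT : finGroupType) (G T A B C : {group gT}) :
  A \subset G -> B \subset G -> C \subset G -> G \subset 'N(T) ->
  [~: A, B, C] \subset T -> [~: B, C, A] \subset T -> [~: C, A, B] \subset T.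
Proof.
move=> sAG sBG sCG nTG.
have nA := subset_trans sAG nTG; have nB := subset_trans sBG nTG.
have nC := subset_trans sCG nTG.
have aux (X Y Z : {group gT}) : X \subset 'N(T) -> Y \subset 'N(T) ->
    Z \subset 'N(T) -> ([~: X, Y, Z] \subset T) = ([~: X / T, Y / T, Z / T] == 1).
  move=> nX nY nZ; have nXY := comm_subG nX nY; have nXYZ := comm_subG nXY nZ.
  by rewrite -(quotientR nX nY) -(quotientR nXY nZ) -subG1 quotient_sub1.
rewrite !aux // => /eqP h1 /eqP h2; apply/eqP; exact: three_subgroup.
Qed.

End ThreeSubgroups.

Section NormalComm.
Import GroupScope.
Variables (gT : finGroupType) (G J : {group gT}).
Hypothesis nJG : G \subset 'N(J).
Implicit Types (x y z u v w : gT).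

Lemma comm_memC x y : ([~ x, y] \in J) = ([~ y, x] \in J).
Proof. by rewrite -invg_comm groupV. Qed.

Lemma memJ_normal x y : y \in G -> (x ^ y \in J) = (x \in J).
Proof. by move=> Gy; rewrite memJ_norm // (subsetP nJG). Qed.

Lemma commMl x x' y : x' \in G -> [~ x, y] \in J ->
  ([~ x * x', y] \in J) = ([~ x', y] \in J).
Proof. by move=> Gx' xyJ; rewrite commMgJ groupMl // memJ_normal. Qed.

Lemma commMl' x x' y : x' \in G -> [~ x', y] \in J ->
  ([~ x * x', y] \in J) = ([~ x, y] \in J).
Proof. by move=> Gx' xyJ; rewrite commMgJ groupMr // memJ_normal. Qed.

Lemma commMr x y y' : y' \in G -> [~ x, y] \in J ->
  ([~ x, y * y'] \in J) = ([~ x, y'] \in J).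
Proof. by move=> Gy' xyJ; rewrite commgMJ groupMr // memJ_normal. Qed.

Lemma commMr' x y y' : y' \in G -> [~ x, y'] \in J ->
  ([~ x, y * y'] \in J) = ([~ x, y] \in J).
Proof. by move=> Gy' xyJ; rewrite commgMJ groupMl // memJ_normal. Qed.

Lemma commVl x y : x \in G -> ([~ x^-1, y] \in J) = ([~ x, y] \in J).
Proof.
move=> Gx; have := commMgJ x x^-1 y; rewrite mulgV comm1g => e.
have : [~ x, y] ^ x^-1 * [~ x^-1, y] \in J by rewrite -e group1.
rewrite -[RHS](memJ_normal _ (groupVr Gx)) => h.
by apply/idP/idP=> k; move: h; rewrite ?(groupMl _ k) ?(groupMr _ k).
Qed.

Lemma comm_kernel y :
  exists C : {group gT}, forall x, (x \in C) = (x \in G) && ([~ x, y] \in J).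
Proof.
have gP : group_set [set z in G | [~ z, y] \in J].
  apply/group_setP; split; first by rewrite inE group1 comm1g group1.
  move=> a b; rewrite !inE => /andP[Ga aJ] /andP[Gb bJ].
  by rewrite groupM // commMl.
by exists (Group gP) => x; rewrite inE.
Qed.

Lemma comm_gen (S : {set gT}) y : S \subset G ->
  (forall x, x \in S -> [~ x, y] \in J) -> forall x, x \in <<S>> -> [~ x, y] \in J.
Proof.
move=> sSG hS x xS; have [C CP] := comm_kernel y.
suffices /subsetP/(_ x xS): <<S>> \subset C by rewrite CP => /andP[].
by rewrite gen_subG; apply/subsetP=> z zS; rewrite CP (subsetP sSG) //= hS.
Qed.

Lemma comm_expgl x y n : x \in G -> [~ x, y] \in J -> [~ x ^+ n, y] \in J.
Proof.
move=> Gx xyJ; elim: n => [|n IH]; first by rewrite comm1g group1.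
by rewrite expgS commMl // groupX.
Qed.

End NormalComm.

Section LowerCentral.
Import GroupScope.
Variables (gT : finGroupType) (G : {group gT}).
Local Notation g n := ('L_n.+1(G)).
Implicit Types (x y z u v w : gT) (J : {group gT}) (s X : seq gT).

(** [g n] has degree [n + 1], so the extra successor expresses additivity of degrees. *)
Lemma lcn_commg_sub m n : [~: g m, g n] \subset g (m + n).+1.
Proof.
elim: n m => [|n IH] m; first by rewrite addn0 -lcnSn.
rewrite (lcnSn n) commGC.
apply: (@three_subgroup_mod _ G 'L_(m + n.+1).+2(G) G 'L_m.+1(G) 'L_n.+1(G));
  rewrite ?lcn_sub ?lcn_norm //.
  by rewrite (commGC G) -lcnSn addnS -addSn; exact: IH.
by rewrite /= lcnSn commSg // addnS IH.
Qed.

Lemma lcn_comm m n x y : x \in g m -> y \in g n -> [~ x, y] \in g (m + n).+1.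
Proof. by move=> gx gy; apply: (subsetP (lcn_commg_sub m n)); apply: mem_commg. Qed.

(** Such a [J] stands for a subgroup of the homogeneous component [g n / g n.+1] of the graded Lie
    ring; this section is central, so [J] is normal in [G]. *)
Definition layer n J := (g n.+1 \subset J) && (J \subset g n).

Lemma layer_norm n J : layer n J -> G \subset 'N(J).
Proof.
case/andP=> sgJ sJg; rewrite -commg_subl; apply: subset_trans sgJ.
by rewrite lcnSn commSg.
Qed.

Lemma lcn_mem m n x : n <= m -> x \in g m -> x \in g n.
Proof. by move=> le_nm; apply: subsetP; apply: lcn_sub_leq. Qed.

Lemma lcn_memG n x : x \in g n -> x \in G.
Proof. exact: subsetP (lcn_sub _ _) x. Qed.

Lemma layer_congl m n J x x' y : layer (m + n).+1 J ->
  x \in G -> x' \in g m.+1 -> y \in g n -> ([~ x * x', y] \in J) = ([~ x, y] \in J).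
Proof.
move=> lJ Gx gx' gy; have nJ := layer_norm lJ.
rewrite (commMl' nJ) ?(lcn_memG gx') //.
by case/andP: lJ => /subsetP + _; apply; rewrite -addSn lcn_comm.
Qed.

(** Bilinearity of the graded bracket: each further factor costs a commutator [[~ x, q, x ^+ k]],
    which lies deeper and hence in [J]. *)
Lemma layer_expg m n J x q k : layer (m + n).+1 J -> x \in g m -> q \in g n ->
  ([~ x ^+ k, q] \in J) = ([~ x, q] ^+ k \in J).
Proof.
move=> lJ gx gq; have nJ := layer_norm lJ.
have [Gx Gq] := (lcn_memG gx, lcn_memG gq); have gxq := lcn_comm gx gq.
suffices hk : [~ x ^+ k, q]^-1 * [~ x, q] ^+ k \in J.
  apply/idP/idP=> h; move: hk; first by rewrite groupMl ?groupV.
  by rewrite (groupMr _ h) groupV.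
elim: k => [|k IH]; first by rewrite comm1g invg1 mulg1 group1.
have ck : [~ x, q, x ^+ k] \in J.
  have /andP[/subsetP-> //] := lJ.
  have := @lcn_comm (m + n).+1 0 [~ x, q] (x ^+ k); rewrite addn0; apply=> //.
  by rewrite lcn1 groupX.
rewrite (expgS x) commMgJ conjg_mulR (expgS [~ x, q]).
have -> a b c d : (a * c * b)^-1 * (a * d) = c^-1 ^ b * (b^-1 * d) :> gT.
  by rewrite conjgE !invMg !mulgA mulgKV mulgK.
by rewrite groupM // (memJ_normal nJ) ?groupV // groupR ?groupX.
Qed.

Lemma layer_conjV m n J u w v : layer (m + n).+1 J ->
  u \in g m -> w \in G -> v \in g n -> ([~ u^-1 ^ w, v] \in J) = ([~ u, v] \in J).
Proof.
move=> lJ gu Gw gv; have nJ := layer_norm lJ; have Gu := lcn_memG gu.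
rewrite conjg_mulR (layer_congl lJ) ?groupV // ?(commVl nJ) //.
by have := @lcn_comm m 0 u^-1 w; rewrite addn0; apply; rewrite ?groupV.
Qed.

(** Hall-Witt: [aux] strips inverses and conjugations, which are invisible modulo [J], and once one
    factor lies in [J] so does the product of the other two. *)
Lemma jacobi a b c J x y z : layer (a + b + c).+2 J ->
    x \in g a -> y \in g b -> z \in g c -> [~ x, y, z] \in J ->
  ([~ y, z, x] \in J) = ([~ z, x, y] \in J).
Proof.
have aux a' b' c' u v w : layer (a' + b' + c').+2 J -> u \in g a' -> v \in g b' ->
    w \in g c' -> ([~ u, v^-1, w] ^ v \in J) = ([~ u, v, w] \in J).
  move=> lJ gu gv gw; have nJ := layer_norm lJ.
  have Gv := lcn_memG gv; rewrite (memJ_normal nJ) //.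
  have -> : [~ u, v^-1] = [~ u, v]^-1 ^ v^-1.
    have := commgMJ u v v^-1; rewrite mulgV commg1 => e.
    by apply: (mulIg ([~ u, v] ^ v^-1)); rewrite -e conjVg mulVg.
  by rewrite (@layer_conjV (a' + b').+1 c') ?addSn ?lcn_comm ?groupV.
move=> lJ gx gy gz xyzJ.
have := Hall_Witt_identity x y z; have := aux _ _ _ _ _ _ lJ gx gy gz.
rewrite xyzJ => h /eqP; rewrite -mulgA -eq_invg_mul => /eqP e.
have: [~ y, z^-1, x] ^ z * [~ z, x^-1, y] ^ x \in J by rewrite -e groupV.
rewrite -(@aux b c a y z x) 1?addnC ?addnA // -(@aux c a b z x y) //; last first.
  by rewrite -addnA addnC.
by move=> hm; apply/idP/idP=> k; move: hm; rewrite ?(groupMl _ k) ?(groupMr _ k).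
Qed.

(** When [J] absorbs [[~ x, [~ u, v]]], Jacobi makes [ad x] self-adjoint up to sign for the
    commutator pairing of [u] and [v]. *)
Lemma letter_swap a b c J x u v : layer (a + b + c).+2 J ->
    x \in g a -> u \in g b -> v \in g c -> [~ x, [~ u, v]] \in J ->
  ([~ u, [~ x, v]] \in J) = ([~ v, [~ x, u]] \in J).
Proof.
move=> lJ gx gu gv; have nJ := layer_norm lJ; rewrite comm_memC => uvxJ.
have l' : layer (b + c + a).+2 J by rewrite addnC addnA.
rewrite (comm_memC J v) comm_memC -(jacobi l' gu gv gx uvxJ).
have [Gx Gv] := (lcn_memG gx, lcn_memG gv).
by rewrite -(invg_comm v x) (commVl nJ) // groupR.
Qed.

End LowerCentral.

(** * Letters, words and the radical *)

Section Words.
Import GroupScope.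
Variables (gT : finGroupType) (p : nat) (G : {group gT}).
Hypothesis pG : p.-group G.
Local Notation g n := ('L_n.+1(G)).
Implicit Types (x y z u v w : gT) (J : {group gT}) (s X : seq gT) (U : {set gT}).

Let nilG : nilpotent G := pgroup_nil pG.

Lemma lcn_eventually_trivial n : #|G| <= n -> g n = 1.
Proof.
move=> le_Gn; apply: (lcn_nil_classP n nilG).
by apply: leq_trans le_Gn; rewrite ltnW // -nilpotent_class.
Qed.

Definition word X z := foldr (fun x u => [~ x, u]) z X.

Lemma word_cat X Y z : word (X ++ Y) z = word X (word Y z).
Proof. by rewrite /word foldr_cat. Qed.

Lemma word_mem X n z : {subset X <= G} -> z \in g n -> word X z \in g (n + size X).
Proof.
elim: X => [|x X IH] sXG gz /=; first by rewrite addn0.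
have:= @lcn_comm _ G 0 (n + size X) x (word X z); rewrite add0n addnS; apply.
  by rewrite lcn1 sXG ?mem_head.
by apply: IH => // y yX; rewrite sXG // inE yX orbT.
Qed.

(* [letters s n] lies between ['L_n.+2(G)] and ['L_n.+3(G)] and represents the part
   of degree [n + 2] of the sum of the images of [ad x], for [x] in [s]. *)
Fixpoint letters s n : {group gT} :=
  if s is x :: s' then (letters s' n <*> [~: [set x], g n])%G else 'L_n.+3(G)%G.

Lemma letters_ge s n : g n.+2 \subset letters s n.
Proof. by elim: s => //= x s IH; rewrite (subset_trans IH) ?joing_subl. Qed.

Lemma letters_comm s n x z : x \in s -> z \in g n -> [~ x, z] \in letters s n.
Proof.
elim: s => //= y s IH; rewrite inE => /predU1P[->|xs] gz.
  by rewrite mem_gen // inE orbC mem_commg ?set11.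
by rewrite mem_gen // inE IH.
Qed.

Lemma letters_min s n J : g n.+2 \subset J ->
  (forall x z, x \in s -> z \in g n -> [~ x, z] \in J) -> letters s n \subset J.
Proof.
move=> gJ; elim: s => //= x s IH h; rewrite join_subG IH; last first.
  by move=> y z ys gz; rewrite h // inE ys orbT.
rewrite gen_subG; apply/subsetP=> _ /imset2P[y z /set1P-> gz ->].
by rewrite h ?mem_head.
Qed.

Lemma letters_layer s n : {subset s <= G} -> layer G n.+1 (letters s n).
Proof.
move=> sG; rewrite /layer letters_ge /=; apply: letters_min.
  exact: lcn_subS.
move=> x z xs gz; have:= @lcn_comm _ G 0 n x z; rewrite add0n; apply=> //.
by rewrite lcn1 sG.
Qed.

Lemma lettersS s t n : {subset s <= t} -> letters s n \subset letters t n.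
Proof.
move=> st; apply: letters_min; first exact: letters_ge.
by move=> x z xs gz; rewrite letters_comm ?st.
Qed.

(* Modulo [letters s], the letters of [s] act as self-adjoint operators for the
   commutator pairing, up to sign. *)
Lemma word_adjoint s X a b u v J : {subset s <= G} -> {subset X <= s} ->
    layer G (a + b + size X).+1 J -> letters s (a + b + size X) \subset J ->
    u \in g a -> v \in g b ->
  ([~ u, word X v] \in J) = ([~ v, word (rev X) u] \in J).
Proof.
move=> sG; elim: X a u => [|x X IH] a u Xs lJ KJ gu gv /=; first exact: comm_memC.
have xs : x \in s by rewrite Xs ?mem_head.
have Gx : x \in g 0 by rewrite lcn1 sG.
have Xs' : {subset X <= s} by move=> y yX; rewrite Xs // inE yX orbT.
have gw : word X v \in g (b + size X) by rewrite word_mem // => y /Xs'/sG.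
rewrite (@letter_swap _ G 0 a (b + size X)) //; last 2 first.
- by rewrite add0n addnA; move: lJ; rewrite /= addnS.
- apply: (subsetP KJ); apply: letters_comm => //=; rewrite addnS -addnA.
  exact: lcn_comm.
rewrite comm_memC (IH a.+1) //.
- by rewrite rev_cons -cats1 word_cat.
- by move: lJ; rewrite /= addnS !addSn.
- by move: KJ; rewrite /= addnS !addSn.
- by have:= @lcn_comm _ G 0 a x u; rewrite add0n; apply.
Qed.

(* Words of length at least [#|G|] act trivially, so bounding the length loses
   nothing; see [radP]. *)
Definition rad (J : nat -> {group gT}) s U : {set gT} :=
  [set r in G | [forall k : 'I_#|G|, forall X : k.-tuple gT,
     all (mem s) X ==> [forall u in U, [~ r, word X u] \in J k]]].

Lemma radP (J : nat -> {group gT}) s U r : {subset s <= G} -> U \subset G ->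
  reflect (r \in G /\ forall X, {subset X <= s} ->
             forall u, u \in U -> [~ r, word X u] \in J (size X))
          (r \in rad J s U).
Proof.
move=> sG UG; rewrite inE; apply: (iffP andP) => [[Gr h]|[Gr h]]; split=> //.
  move=> X Xs u Uu; case: (ltnP (size X) #|G|) => [ltX|leX]; last first.
    have: [~ r, word X u] \in g (size X).+1.
      have:= @lcn_comm _ G 0 (size X) r (word X u); rewrite add0n; apply=> //.
      have:= @word_mem X 0 u; rewrite add0n; apply; first by move=> y /Xs/sG.
      by rewrite lcn1 (subsetP UG).
    by rewrite lcn_eventually_trivial ?(leqW leX) // => /set1P->.
  move/forallP/(_ (Ordinal ltX))/forallP/(_ (in_tuple X))/implyP: h => /=.
  by move/(_ (introT allP Xs))/forall_inP/(_ u Uu).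
apply/forallP=> k; apply/forallP=> X; apply/implyP=> /allP Xs.
by apply/forall_inP=> u Uu; rewrite -{2}(size_tuple X) h.
Qed.

Lemma rad_group_set (J : nat -> {group gT}) s U : {subset s <= G} -> U \subset G ->
  (forall n, layer G n.+1 (J n)) -> group_set (rad J s U).
Proof.
move=> sG UG lJ; apply/group_setP; split.
  by apply/radP=> //; split=> // X _ u _; rewrite comm1g group1.
move=> a b /radP[]// Ga ha /radP[]// Gb hb.
apply/radP=> //; split=> [|X Xs u Uu]; first by rewrite groupM.
by rewrite (commMl (layer_norm (lJ _))) ?ha ?hb.
Qed.

(** The Frattini factor allows computing modulo [p]-th powers; [lettersPhi_full] shows that fullness
    is not affected, since Frattini elements are nongenerators. *)
Definition lettersPhi s n : {group gT} := (letters s n <*> 'Phi(g n.+1))%G.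

Lemma lettersPhi_layer s n : {subset s <= G} -> layer G n.+1 (lettersPhi s n).
Proof.
move=> sG; have /andP[h1 h2] := letters_layer n sG.
rewrite /layer (subset_trans h1) ?joing_subl //= join_subG h2 Phi_sub //.
Qed.

Lemma lettersPhi_ge s n : letters s n \subset lettersPhi s n.
Proof. exact: joing_subl. Qed.

Lemma lettersPhi_full s n : {subset s <= G} ->
  g n.+1 \subset lettersPhi s n -> letters s n = 'L_n.+2(G)%G.
Proof.
move=> sG h; have /andP[_ sub] := letters_layer n sG.
have /andP[_ sub2] := lettersPhi_layer n sG.
apply/val_inj => /=; rewrite -[LHS]genGid; apply: Phi_nongen.
by rewrite joingC; apply/eqP; rewrite eqEsubset sub2.
Qed.

(** The Frattini subgroup is generated by the derived subgroup, whose commutators with [q] lie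
    deeper, and by [p]-th powers, which [layer_expg] carries to [p]-th powers. *)
Lemma Phi_comm m n v q : v \in 'Phi(g m) -> q \in g n ->
  [~ v, q] \in ('Phi(g (m + n).+1) <*> g (m + n).+2)%G.
Proof.
move=> Phiv gq; set J := (_ <*> _)%G.
have pL k : p.-group (g k) by apply: pgroupS pG; apply: lcn_sub.
have lJ : layer G (m + n).+1 J.
  by rewrite /layer joing_subr join_subG Phi_sub lcn_subS.
have nJ := layer_norm lJ.
move: Phiv; rewrite (Phi_joing (pL m)) (MhoE 1 (pL m)) joing_idr.
apply: (comm_gen nJ).
  rewrite subUset (subset_trans (der_sub _ _)) ?lcn_sub //=.
  by apply/subsetP=> _ /imsetP[x + ->] /=; move=> /lcn_memG Gx; rewrite groupX.
have gJ : g (m + n).+2 \subset J by rewrite joing_subr.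
move=> v' /setUP[vd|].
  apply: (subsetP gJ).
  have: v' \in g (m + m).+1 by apply: (subsetP (lcn_commg_sub G m m)).
  by move/lcn_comm/(_ gq); apply: lcn_mem; lia.
case/imsetP=> x gx ->; rewrite expn1 {v'}.
have Gx := lcn_memG gx.
have gxq : [~ x, q] \in g (m + n).+1 by rewrite lcn_comm.
have: [~ x, q] ^+ p \in J.
  apply: (subsetP (joing_subl _ _)); rewrite (Phi_joing (pL _)).
  apply: (subsetP (joing_subr _ _)); rewrite -[X in _ ^+ X]expn1.
  by rewrite (Mho_p_elt 1 gxq) // (mem_p_elt (pL _) gxq).
by rewrite (@layer_expg _ G m n).
Qed.

Lemma lettersPhi_min s n J : letters s n \subset J -> 'Phi(g n.+1) \subset J ->
  lettersPhi s n \subset J.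
Proof. by rewrite join_subG => -> ->. Qed.

(** Measures how much of the derived subgroup the letters miss; for empty [s] it is the logarithm of
    its order. Terms past [#|G|] would be trivial. *)
Definition defect s := \sum_(n < #|G|) logn p #|g n.+1 : letters s n|.
(* The breadth of [x] in the graded ring modulo [letters s]. *)
Definition brank s x := \sum_(n < #|G|) logn p #|letters (x :: s) n : letters s n|.

Lemma defect_cons s x : {subset x :: s <= G} ->
  defect s = (brank s x + defect (x :: s))%N.
Proof.
move=> xsG; rewrite /defect /brank -big_split; apply: eq_bigr => n _ /=.
have /andP[_ sub] := letters_layer n xsG.
rewrite -lognM // mulnC (Lagrange_index sub) //; apply: lettersS.
by move=> y ys; rewrite inE ys orbT.
Qed.

Lemma defect_eq0 s : (forall n, letters s n = 'L_n.+2(G)%G) -> defect s = 0.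
Proof. by move=> e; rewrite /defect big1 // => n _; rewrite e indexgg logn1. Qed.
End Words.

Section Radical.
Import GroupScope.
Variables (gT : finGroupType) (p : nat) (G : {group gT}).
Hypothesis pG : p.-group G.
Local Notation g n := ('L_n.+1(G)).
Local Notation letters := (letters G).
Local Notation lettersPhi := (lettersPhi G).
Implicit Types (x y z u v w : gT) (J : {group gT}) (s X : seq gT) (U : {set gT}).

Lemma letters_commP s n q J : {subset s <= G} -> G \subset 'N(J) ->
    (forall v, v \in g n.+2 -> [~ v, q] \in J) ->
    (forall x z, x \in s -> z \in g n -> [~ [~ x, z], q] \in J) ->
  forall v, v \in letters s n -> [~ v, q] \in J.
Proof.
move=> sG nJ h1 h2 v; have [C CP] := comm_kernel nJ q.
suffices /subsetP sub: letters s n \subset C by move/sub; rewrite CP => /andP[].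
apply: letters_min => [|x z xs gz].
  by apply/subsetP=> z gz; rewrite CP (lcn_memG gz) h1.
have [Gx Gz] := (sG _ xs, lcn_memG gz); by rewrite CP; apply/andP; split; [apply: groupR | apply: h2].
Qed.

(** The common radical of the pairings of [r] and [u] by [[~ r, word X u]], one for each word [X] in
    the letters, modulo letters and [p]-th powers. *)
Definition radical s : {set gT} := rad G (lettersPhi s) s G.

Lemma radical_sub s : radical s \subset G.
Proof. by apply/subsetP=> r; rewrite inE => /andP[]. Qed.

(* A letter [y] of [ys] in the word is traded for letters of [s] at the same depth,
   at the price of arbitrary letters above it: [[y, rev X r]] lies in
   [lettersPhi s] because [r] is in the radical. *)
Lemma radical_step s ys d e q J : {subset s <= G} -> {subset ys <= G} ->
    G \subset <<radical s :|: [set y in ys]>> ->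
    (forall i, i < d + e -> letters (ys ++ s) i = 'L_i.+2(G)%G) ->
    q \in g e -> layer G (d + e).+1 J -> lettersPhi (ys ++ s) (d + e) \subset J ->
    (forall r X, r \in radical s -> {subset X <= s} -> size X = d ->
       [~ r, word X q] \in J) ->
  forall v, v \in g d -> [~ v, q] \in J.
Proof.
move=> sG yG genG; elim: d e q => [|d IH] e q full gq lJ KJ hX v gv.
  have nJ := layer_norm lJ; move: gv; rewrite lcn1 => /(subsetP genG).
  apply: (comm_gen nJ).
    by rewrite subUset radical_sub; apply/subsetP=> y; rewrite inE => /yG.
  move=> x /setUP[xR|]; first exact: (hX x [::]).
  rewrite inE => xy; apply: (subsetP KJ); apply: (subsetP (lettersPhi_ge _ _ _)).
  by apply: letters_comm; rewrite ?mem_cat ?xy ?add0n.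
have tG : {subset ys ++ s <= G}.
  by move=> x; rewrite mem_cat => /orP[/yG|/sG].
have nJ := layer_norm lJ.
have gJ : g (d.+1 + e).+2 \subset J by case/andP: lJ.
(* Fullness in lower degree reduces [v] to commutators [[~ l, w]] with [l] a letter, modulo deeper
   terms. *)
have {gv}: v \in letters (ys ++ s) d by rewrite full // addSn ltnS leq_addr.
move: v.
have swap l w : l \in ys ++ s -> w \in g d ->
    ([~ [~ l, w], q] \in J) = ([~ w, [~ l, q]] \in J).
  move=> lt gw; rewrite (comm_memC J _ q).
  have Gl : l \in g 0 by rewrite lcn1 tG.
  rewrite (@letter_swap _ G 0 d e _ l w q) //.
    apply: (subsetP KJ); apply: (subsetP (lettersPhi_ge _ _ _)).
    by apply: letters_comm => //=; rewrite lcn_comm.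
have base w : w \in g d.+2 -> [~ w, q] \in J.
  by move=> gw; apply: (subsetP gJ); rewrite -addSn lcn_comm.
have lq l : l \in ys ++ s -> [~ l, q] \in g e.+1.
  move=> lt; have := @lcn_comm _ G 0 e l q; rewrite add0n; apply=> //.
  by rewrite lcn1 tG.
have IHl l : l \in ys ++ s -> (forall r X, r \in radical s -> {subset X <= s} ->
    size X = d -> [~ r, word X [~ l, q]] \in J) ->
    forall w, w \in g d -> [~ w, [~ l, q]] \in J.
  move=> lt; apply: (IH e.+1); rewrite ?addnS ?lq //.
have stepS l : l \in s -> forall w, w \in g d -> [~ w, [~ l, q]] \in J.
  move=> ls; apply: IHl; first by rewrite mem_cat ls orbT.
  move=> r X rR Xs sX; have -> : word X [~ l, q] = word (X ++ [:: l]) q.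
    by rewrite word_cat.
  apply: hX; rewrite ?size_cat ?sX ?addn1 // => x.
  by rewrite mem_cat inE => /orP[/Xs|/eqP->].
apply: letters_commP => // l w; rewrite mem_cat => /orP[ly|ls] gw; last first.
  by rewrite swap ?mem_cat ?ls ?orbT // stepS.
have lt : l \in ys ++ s by rewrite mem_cat ly.
rewrite swap //; move: w gw; apply: IHl => // r X rR Xs sX.
have /(radP pG _ _ sG (subxx _))[Gr hr] := rR.
have Gl := yG _ ly.
have gX : word (rev X) r \in g d.
  have:= @word_mem _ G (rev X) 0 r; rewrite add0n size_rev sX; apply.
    by move=> x; rewrite mem_rev => /Xs/sG.
  by rewrite lcn1.
have KsJ : letters s (d.+1 + e) \subset J.
  apply: subset_trans KJ; apply: subset_trans (lettersPhi_ge _ _ _).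
  by apply: lettersS => x xs; rewrite mem_cat xs orbT.
have edim : (0 + e.+1 + size X = d.+1 + e)%N by rewrite sX add0n addSn addnC -addSn.
(* Adjointness moves the word from [[~ l, q]] onto [r]; swapping [l] back leaves
   [[~ l, word (rev X) r]] against [q]. *)
rewrite (@word_adjoint _ G s X 0 e.+1) ?edim ?lcn1 ?lq // comm_memC -swap //.
have yrR : [~ l, word (rev X) r] \in lettersPhi s d.
  have := hr X Xs l Gl.
  by rewrite (@word_adjoint _ G s X 0 0) ?lcn1 ?add0n ?sX ?lettersPhi_layer ?lettersPhi_ge.
apply: (comm_gen nJ _ _ yrR).
  rewrite subUset; have /andP[_ sub] := letters_layer d sG.
  by rewrite (subset_trans sub) ?lcn_sub ?(subset_trans (Phi_sub _)) ?lcn_sub.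
move=> k /setUP[|kPhi].
  apply: letters_commP => // a w aS gw.
  by rewrite swap ?mem_cat ?aS ?orbT // stepS.
have := Phi_comm pG kPhi gq; apply: subsetP; rewrite join_subG gJ andbT.
exact: subset_trans (joing_subr _ _) KJ.
Qed.

(** Induction on the degree: with lower degrees full, [radical_step] at [e = 0] puts all commutators
    of [g n] with [G] into [lettersPhi]. *)
Lemma radical_full s ys : {subset s <= G} -> {subset ys <= G} ->
    G \subset <<radical s :|: [set y in ys]>> ->
  defect p G (ys ++ s) = 0.
Proof.
move=> sG yG genG.
have tG : {subset ys ++ s <= G}.
  by move=> x; rewrite mem_cat => /orP[/yG|/sG].
apply: defect_eq0 => n; elim/ltn_ind: n => n IH; apply: (lettersPhi_full tG).
have lK := lettersPhi_layer n tG.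
rewrite lcnSn gen_subG; apply/subsetP=> _ /imset2P[v q gv Gq ->].
move: v gv; apply: (@radical_step s ys n 0 q) => //; rewrite ?addn0 //.
move=> r X /(radP pG _ _ sG (subxx _))[Gr hr] Xs sX.
have := hr X Xs q Gq; rewrite sX; apply: subsetP.
apply: lettersPhi_min; last exact: joing_subr.
apply: subset_trans (lettersPhi_ge _ _ _).
by apply: lettersS => x xs; rewrite mem_cat xs orbT.
Qed.
End Radical.

(** * Change of graded breadth when a letter is adjoined *)

Section Rank.
Import GroupScope.
Variables (gT : finGroupType) (p : nat) (G : {group gT}).
Hypothesis (p_pr : prime p) (pG : p.-group G).
Local Notation g n := ('L_n.+1(G)).
Local Notation letters := (letters G).
Local Notation lettersPhi := (lettersPhi G).
Local Notation brank := (brank p G).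
Implicit Types (x y z u v w : gT) (J : {group gT}) (s X : seq gT) (U : {set gT}).

Lemma cons_sub s x : {subset s <= G} -> x \in G -> {subset x :: s <= G}.
Proof. by move=> sG Gx y; rewrite inE => /predU1P[->|/sG]. Qed.

(** The operators of [y * x ^+ k] and [y] differ by a multiple of [ad x], already divided out. Later
    arguments may thus translate [y] by powers of [x] to avoid subgroups. *)
Lemma letters_translate s x y k n : {subset s <= G} -> x \in s -> y \in G ->
  letters (y * x ^+ k :: s) n = letters (y :: s) n.
Proof.
move=> sG xs Gy; have Gx := sG x xs.
have sub t t' : {subset y :: y * x ^+ k :: s <= G} -> t = y \/ t = y * x ^+ k ->
  t' = y \/ t' = y * x ^+ k -> letters (t :: s) n \subset letters (t' :: s) n.
  move=> ysG ht ht'.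
  have Gt' : t' \in G by case: ht' => ->; rewrite ?groupM ?groupX.
  have lJ := letters_layer n (cons_sub sG Gt'); have nJ := layer_norm lJ.
  apply: letters_min => [|z w]; first by case/andP: lJ.
  rewrite inE => /predU1P[->|zs] gw; last by rewrite letters_comm // inE zs orbT.
  have tw := letters_comm (mem_head t' s) gw.
  have xw : [~ x ^+ k, w] \in letters (t' :: s) n.
    by rewrite (comm_expgl nJ) // letters_comm // inE xs orbT.
  have yE : ([~ y * x ^+ k, w] \in letters (t' :: s) n) = ([~ y, w] \in letters (t' :: s) n).
    by rewrite (commMl' nJ) ?groupX.
  case: ht => ->; first by case: ht' tw => et; rewrite {1}et // yE.
  by rewrite yE; case: ht' tw => et; rewrite {1}et // yE.
have h : {subset y :: y * x ^+ k :: s <= G}.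
  exact: cons_sub (cons_sub sG (groupM Gy (groupX k Gx))) Gy.
by apply/val_inj/eqP; rewrite eqEsubset !sub //; [left | right | right | left].
Qed.

Lemma brank_translate s x y k : {subset s <= G} -> x \in G -> y \in G ->
  brank (x :: s) (y * x ^+ k) = brank (x :: s) y.
Proof.
move=> sG Gx Gy; apply: eq_bigr => n _.
by rewrite (letters_translate k) ?mem_head //; apply: cons_sub.
Qed.

Lemma letters_pgroup s n : {subset s <= G} -> p.-group (letters s n).
Proof.
move=> sG; apply: pgroupS pG; have /andP[_ sub] := letters_layer n sG.
exact: subset_trans sub (lcn_sub _ _).
Qed.

Lemma letters_subG s n : {subset s <= G} -> letters s n \subset G.
Proof.
move=> sG; have /andP[_ sub] := letters_layer n sG.
exact: subset_trans sub (lcn_sub _ _).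
Qed.

(** The two letters together give the join of [A] and [B]; by the second isomorphism theorem the
    rank lost is that of [A :&: B] over [letters s n]. *)
Lemma brank_term_drop s x y n : {subset s <= G} -> x \in G -> y \in G ->
  logn p #|letters (y :: x :: s) n : letters (x :: s) n| +
    logn p #|letters (y :: s) n :&: letters (x :: s) n : letters s n|
    = logn p #|letters (y :: s) n : letters s n|.
Proof.
move=> sG Gx Gy; set A := letters (y :: s) n; set B := letters (x :: s) n.
have lA := letters_layer n (cons_sub sG Gy); have lB := letters_layer n (cons_sub sG Gx).
have nAB : A \subset 'N(B).
  exact: subset_trans (letters_subG n (cons_sub sG Gy)) (layer_norm lB).
have KAB : letters s n \subset A :&: B.
  by rewrite subsetI !lettersS // => z zs; rewrite inE zs orbT.
have -> : letters (y :: x :: s) n = (A <*> B)%G.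
  apply/val_inj/eqP; rewrite eqEsubset; apply/andP; split.
    apply: letters_min => [|z w].
      by case/andP: lA => sub _; apply: subset_trans sub (joing_subl _ _).
    rewrite !inE => /or3P[/eqP->|/eqP->|zs] gw.
    - by apply: (subsetP (joing_subl _ _)); rewrite letters_comm ?mem_head.
    - by apply: (subsetP (joing_subr _ _)); rewrite letters_comm ?mem_head.
    by apply: (subsetP (joing_subl _ _)); rewrite letters_comm // inE zs orbT.
  rewrite join_subG !lettersS // => z; rewrite !inE.
    by case/orP=> ->; rewrite ?orbT.
  by case/orP=> ->; rewrite ?orbT.
rewrite /= joingC norm_joinEr // indexMg -indexgI -lognM // Lagrange_index ?subsetIl //.
Qed.

Lemma brank_cons_le s x y : {subset s <= G} -> x \in G -> y \in G ->
  brank (x :: s) y <= brank s y.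
Proof.
move=> sG Gx Gy; apply: leq_sum => n _.
by rewrite -(brank_term_drop n sG Gx Gy) leq_addr.
Qed.

Lemma letters_big s n : {subset s <= G} -> #|G| <= n.+1 -> letters s n = 1%G.
Proof.
move=> sG leG; have /andP[_ sub] := letters_layer n sG.
by apply/val_inj/trivgP; rewrite -(lcn_eventually_trivial pG leG).
Qed.

Lemma letters_index_drop s x y w n : {subset s <= G} -> x \in G -> y \in G ->
    w \in letters (x :: s) n -> w \in letters (y :: s) n -> w \notin letters s n ->
  logn p #|letters (y :: x :: s) n : letters (x :: s) n|
    < logn p #|letters (y :: s) n : letters s n|.
Proof.
move=> sG Gx Gy wx wy ws; rewrite -(brank_term_drop n sG Gx Gy) -addn1 leq_add2l.
have pI : p.-group (letters (y :: s) n :&: letters (x :: s) n).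
  by apply: pgroupS (letters_pgroup n (cons_sub sG Gy)); rewrite subsetIl.
have iP : p.-nat #|letters (y :: s) n :&: letters (x :: s) n : letters s n|.
  exact: pnat_dvd (dvdn_indexg _ _) pI.
have [k ik] := p_natP iP; rewrite /= ik lognX logn_prime // eqxx muln1.
rewrite lt0n; apply/eqP=> k0; move: ik; rewrite k0 expn0 => /eqP.
rewrite indexg_eq1 => /subsetP/(_ w); rewrite inE wx wy => /(_ isT).
exact/negP.
Qed.

Lemma brank_cons_drop s x y w n : {subset s <= G} -> x \in G -> y \in G ->
    w \in letters (x :: s) n -> w \in letters (y :: s) n -> w \notin letters s n ->
  brank (x :: s) y < brank s y.
Proof.
move=> sG Gx Gy wx wy ws.
have ltn : n < #|G|.
  rewrite ltnNge; apply: contra ws => leG; move: wx.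
  by rewrite (letters_big (cons_sub sG Gx) (leqW leG)) => /set1P->.
rewrite /brank (bigD1 (Ordinal ltn)) //= [X in _ < X](bigD1 (Ordinal ltn)) //=.
rewrite -addSn leq_add ?(letters_index_drop sG Gx Gy wx wy ws) //.
by apply: leq_sum => m _; rewrite -(brank_term_drop m sG Gx Gy) leq_addr.
Qed.
End Rank.

(** * The bound from successive letters *)

Section Membership.
Import GroupScope.

Lemma proper_setU_neq (gT : finGroupType) (G A B : {group gT}) :
  A \proper G -> B \proper G -> exists x, [/\ x \in G, x \notin A & x \notin B].
Proof.
move=> /properP[_ [a Ga nAa]] /properP[_ [b Gb nBb]].
case: (boolP (a \in B)) => Ba; last by exists a.
case: (boolP (b \in A)) => Ab; last by exists b.
by exists (a * b); rewrite groupM // groupMr // groupMl.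
Qed.

Lemma mem_expg_coprime (gT : finGroupType) (H : {group gT}) x k :
  coprime #[x] k -> x ^+ k \in H -> x \in H.
Proof.
rewrite -generator_coprime => /eqP gx xkH.
by rewrite -(cycle_subG x) gx cycle_subG.
Qed.

End Membership.

(** * Orthogonality under the word pairings *)

Section Defect.
Import GroupScope.
Variables (gT : finGroupType) (p : nat) (G : {group gT}).
Hypothesis (p_pr : prime p) (pG : p.-group G).
Local Notation g n := ('L_n.+1(G)).
Local Notation letters := (letters G).
Local Notation lettersPhi := (lettersPhi G).
Local Notation brank := (brank p G).
Implicit Types (x y z u v w : gT) (J : {group gT}) (s X : seq gT) (U : {set gT}).

Lemma word_mem0 X z : {subset X <= G} -> z \in G -> word X z \in g (size X).
Proof.
by move=> XG Gz; have := @word_mem _ G X 0 z; rewrite add0n; apply; rewrite ?lcn1.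
Qed.

Lemma radPn (J : nat -> {group gT}) s U r : r \in G -> r \notin rad G J s U ->
  exists X u, [/\ {subset X <= s}, u \in U & [~ r, word X u] \notin J (size X)].
Proof.
move=> Gr; rewrite inE Gr negb_forall => /existsP[k].
rewrite negb_forall => /existsP[X]; rewrite negb_imply => /andP[/allP Xs].
rewrite negb_forall => /existsP[u]; rewrite negb_imply => /andP[Uu h].
by exists X, u; rewrite size_tuple.
Qed.

Definition radicalG s : {group gT} := <<radical G s>>%G.
(** The orthogonal complement of [x] for all word pairings at once; the generated subgroup only
    supplies a group structure, by [perpE]. *)
Definition perp s x : {group gT} := <<rad G (letters s) s [set x]>>%G.

Lemma radicalGE s : {subset s <= G} -> radicalG s = radical G s :> {set gT}.
Proof.
move=> sG; apply: (gen_set_id (rad_group_set pG sG (subxx _) _)) => n.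
exact: lettersPhi_layer.
Qed.

Lemma perpE s x : {subset s <= G} -> x \in G ->
  perp s x = rad G (letters s) s [set x] :> {set gT}.
Proof.
move=> sG Gx; apply: (gen_set_id (rad_group_set pG sG _ _)) => [|n].
  by rewrite sub1set.
exact: letters_layer.
Qed.

Lemma radicalP s r : {subset s <= G} ->
  reflect (r \in G /\ forall X, {subset X <= s} -> forall u, u \in G ->
             [~ r, word X u] \in lettersPhi s (size X))
          (r \in radicalG s).
Proof.
move=> sG; have -> : (r \in radicalG s) = (r \in radical G s) by rewrite -radicalGE.
exact: (radP pG _ _ sG (subxx _)).
Qed.

Lemma perpP s x y : {subset s <= G} -> x \in G ->
  reflect (y \in G /\ forall X, {subset X <= s} ->
             [~ y, word X x] \in letters s (size X))
          (y \in perp s x).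
Proof.
move=> sG Gx.
have -> : (y \in perp s x) = (y \in rad G (letters s) s [set x]) by rewrite -perpE.
have xG : [set x] \subset G by rewrite sub1set.
apply: (iffP (radP pG _ _ sG xG)) => -[Gy h]; split=> // X Xs; first by apply: h; rewrite ?set11.
by move=> u /set1P->; apply: h.
Qed.

Lemma adjoint0 s X u v J : {subset s <= G} -> {subset X <= s} ->
    layer G (size X).+1 J -> letters s (size X) \subset J -> u \in G -> v \in G ->
  ([~ u, word X v] \in J) = ([~ v, word (rev X) u] \in J).
Proof.
by move=> sG Xs lJ KJ Gu Gv; apply: (@word_adjoint _ G s X 0 0); rewrite ?lcn1.
Qed.

Lemma perp_sym s x y : {subset s <= G} -> x \in G -> y \in perp s x -> x \in perp s y.
Proof.
move=> sG Gx /(perpP _ sG Gx)[Gy h]; apply/perpP=> //; split=> // X Xs.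
have Xs' : {subset rev X <= s} by move=> z; rewrite mem_rev; apply: Xs.
by rewrite (adjoint0 sG) ?letters_layer //; have := h _ Xs'; rewrite size_rev.
Qed.

Lemma perp_sub s x : {subset s <= G} -> x \in G -> perp s x \subset G.
Proof. by move=> sG Gx; apply/subsetP=> y /(perpP _ sG Gx)[]. Qed.

Lemma perp_norm s x : {subset s <= G} -> x \in G -> G \subset 'N(perp s x).
Proof.
move=> sG Gx; apply: sub_der1_norm; last exact: perp_sub.
rewrite -lcn2; apply/subsetP=> r gr.
apply/perpP=> //; split=> [|X Xs]; first exact: lcn_memG gr.
have XG : {subset X <= G} by move=> y /Xs/sG.
have /andP[/subsetP h _] := letters_layer (size X) sG; apply: h.
by have := lcn_comm gr (word_mem0 XG Gx); rewrite add1n.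
Qed.

(** A word with [[~ y, word X x]] outside [letters s] gives, by adjointness, an element common to
    the images of [ad x] and [ad y], which forces a drop. *)
Lemma perp_brank s x y : {subset s <= G} -> x \in G -> y \in G -> y \notin perp s x ->
  brank (x :: s) y < brank s y.
Proof.
move=> sG Gx Gy.
have -> : (y \in perp s x) = (y \in rad G (letters s) s [set x]) by rewrite -perpE.
case/radPn=> // X [_ [Xs /set1P-> h]].
have XG : {subset X <= G} by move=> z /Xs/sG.
have Xs' : {subset X <= x :: s} by move=> z /Xs zs; rewrite inE zs orbT.
have XG' : {subset rev X <= G} by move=> z; rewrite mem_rev; apply: XG.
apply: (brank_cons_drop p_pr pG sG Gx Gy _ _ h).
  rewrite (adjoint0 (cons_sub sG Gx)) ?letters_layer //; last exact: cons_sub.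
  rewrite letters_comm ?mem_head // -(size_rev X); exact: word_mem0.
by rewrite letters_comm ?mem_head // word_mem0.
Qed.

Lemma rank0_letters s x n : {subset s <= G} -> x \in G -> brank s x = 0 ->
  letters (x :: s) n \subset letters s n.
Proof.
move=> sG Gx r0; case: (ltnP n #|G|) => [ltn|leG]; last first.
  by rewrite (letters_big pG (cons_sub sG Gx) (leqW leG)) sub1G.
move/eqP: r0; rewrite /brank sum_nat_eq0 => /forallP/(_ (Ordinal ltn))/= /eqP.
have iP : p.-nat #|letters (x :: s) n : letters s n|.
  exact: pnat_dvd (dvdn_indexg _ _) (letters_pgroup pG n (cons_sub sG Gx)).
have [k ik] := p_natP iP; rewrite /= ik lognX logn_prime // eqxx muln1 => k0.
by rewrite -indexg_eq1 ik k0.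
Qed.

Lemma perp_decomp s x u : {subset s <= G} -> x \in G ->
    G \subset perp s x <*> <[x]> -> u \in G ->
  exists o k, o \in perp s x /\ u = o * x ^+ k.
Proof.
move=> sG Gx genG /(subsetP genG); rewrite norm_joinEr; last first.
  by rewrite cycle_subG (subsetP (perp_norm sG Gx)).
by case/mulsgP=> o _ oP /cycleP[k ->] ->; exists o, k.
Qed.

Lemma perp_radical s x u X J : {subset s <= G} -> x \in G -> u \in perp s x ->
    {subset X <= s} -> letters s (size X) \subset J -> [~ u, word X x] \in J.
Proof. by move=> sG Gx /(perpP _ sG Gx)[_ h] Xs /subsetP-> //; apply: h. Qed.

End Defect.

(** * The stuck case for the prime two *)

Section AllFail.
Import GroupScope.
Variables (gT : finGroupType) (G C : {group gT}).
Hypothesis (pG : 2.-group G).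
Local Notation g n := ('L_n.+1(G)).
Local Notation letters := (letters G).
Local Notation lettersPhi := (lettersPhi G).
Local Notation radicalG := (radicalG G).
Local Notation perp := (perp G).
Implicit Types (x y z u v w : gT) (J : {group gT}) (X : seq gT) (U : {set gT}).
Variable s : seq gT.
Hypothesis sG : {subset s <= G}.
(** No letter [a] off [C] and off the radical leaves a proper subgroup [perp s a <*> <[a]>] outside
    which ranks would drop. *)
Hypothesis spanG : forall a, a \in G -> a \notin C -> a \notin radicalG s ->
  G \subset perp s a <*> <[a]>.

Lemma radicalPn r : r \in G -> r \notin radicalG s ->
  exists X u, [/\ {subset X <= s}, u \in G & [~ r, word X u] \notin lettersPhi s (size X)].
Proof.
move=> Gr; have -> : (r \in radicalG s) = (r \in radical G s) by rewrite -(radicalGE pG).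
exact: radPn.
Qed.

Lemma rev_sub X : {subset X <= s} -> {subset rev X <= s}.
Proof. by move=> Xs x; rewrite mem_rev; apply: Xs. Qed.

Lemma adj X u v J : {subset X <= s} -> layer G (size X).+1 J ->
    letters s (size X) \subset J -> u \in G -> v \in G ->
  ([~ u, word X v] \in J) = ([~ v, word (rev X) u] \in J).
Proof. by move=> Xs; apply: adjoint0. Qed.

Lemma word_memG X u : {subset X <= s} -> u \in G -> word X u \in g (size X).
Proof. by move=> Xs; apply: word_mem0 => x /Xs/sG. Qed.

(* Here [x = o * a ^+ t] with [o] orthogonal to [a], so [[x, X x]] is congruent to
   [[a, X a] ^+ t], and [t] is odd since the left side is nonzero modulo squares
   for some word [X]. *)
Lemma perp_congruent x a v : x \in G -> x \notin C -> x \notin radicalG s ->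
    v \in perp s x -> a = x * v -> a \notin C ->
  a \notin radicalG s /\ forall X u, {subset X <= s} -> u \in G ->
    [~ a, word X u] \in letters (x :: s) (size X).
Proof.
move=> Gx nCx nRx xv ea nCa; have Gv := subsetP (perp_sub pG sG Gx) v xv.
have Ga : a \in G by rewrite ea groupM.
(* Some word pairs [x] nontrivially with some [u = o * x ^+ k]; as [o] is orthogonal to [x], already
   [x] with itself pairs nontrivially. *)
have [X1 [X1s xx1]] : exists X, {subset X <= s} /\
    [~ x, word X x] \notin lettersPhi s (size X).
  have [X [u [Xs Gu h]]] := radicalPn Gx nRx; exists (rev X); split; first exact: rev_sub.
  have lP := lettersPhi_layer (size X) sG; have nP := layer_norm lP.
  move: h; rewrite size_rev (adj Xs lP) ?lettersPhi_ge //.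
  have [o [k [xo ->]]] := perp_decomp pG sG Gx (spanG Gx nCx nRx) Gu.
  apply: contra => xx; rewrite (commMl nP) ?groupX //.
    by rewrite (comm_expgl nP).
  apply: (perp_radical pG sG Gx xo (rev_sub Xs)).
  by rewrite size_rev lettersPhi_ge.
have nRa : a \notin radicalG s.
  apply: contra xx1 => /(radicalP pG _ sG)[_ /(_ _ X1s x Gx)].
  have nP := layer_norm (lettersPhi_layer (size X1) sG).
  by rewrite ea (commMl' nP) // (perp_radical pG sG Gx xv X1s) ?lettersPhi_ge.
have [o [t [ao ex]]] := perp_decomp pG sG Ga (spanG Ga nCa nRa) Gx.
have key X J : {subset X <= s} -> layer G (size X).+1 J -> letters s (size X) \subset J ->
    ([~ a, word X a] ^+ t \in J) = ([~ x, word X x] \in J).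
  move=> Xs lJ KJ; have nJ := layer_norm lJ.
  have lJ' : layer G (0 + size X).+1 J by rewrite add0n.
  have Xr := rev_sub Xs.
  rewrite -(layer_expg t lJ') ?lcn1 ?word_memG //.
  have -> : ([~ a ^+ t, word X a] \in J) = ([~ x, word X a] \in J).
    by rewrite [in RHS]ex (commMl nJ) ?groupX // (perp_radical pG sG Ga ao Xs).
  rewrite (adj Xs lJ KJ) // [in LHS]ea (commMl' nJ) //.
    by rewrite [RHS](adj Xs lJ KJ).
  by apply: (perp_radical pG sG Gx xv Xr); rewrite size_rev.
(* For even [t] the power [[~ a, word X1 a] ^+ t] would be a power of a square, hence in the
   Frattini part, against the choice of [X1]. *)
have codd : coprime 2 t.
  rewrite prime_coprime // dvdn2; apply/negP=> tE.
  move: xx1; rewrite -(key X1) ?lettersPhi_layer ?lettersPhi_ge // => /negP; apply.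
  apply: (subsetP (joing_subr _ _)); have Lp : 2.-group (g (size X1).+1).
    by apply: pgroupS pG; apply: lcn_sub.
  rewrite (Phi_joing Lp) (MhoE 1 Lp); apply: (subsetP (joing_subr _ _)).
  rewrite -(odd_double_half t) (negbTE tE) add0n -mul2n expgM expn1.
  apply/groupX/mem_gen/imset_f.
  have := @lcn_comm _ G 0 (size X1) a (word X1 a); rewrite add0n; apply; rewrite ?lcn1 //.
  exact: word_memG.
have aa X : {subset X <= s} -> [~ a, word X a] \in letters (x :: s) (size X).
  move=> Xs; apply: (@mem_expg_coprime _ _ _ t).
    have Gw : [~ a, word X a] \in G by rewrite groupR // (lcn_memG (word_memG Xs Ga)).
    by have [k ->] := p_natP (mem_p_elt pG Gw); apply: coprimeXl.
  have Xs' : {subset X <= x :: s} by move=> z /Xs zs; rewrite inE zs orbT.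
  rewrite key ?letters_layer // ?lettersS //; last by move=> z zs; rewrite inE zs orbT.
  - by rewrite letters_comm ?mem_head // word_memG.
  exact: cons_sub.
split=> // X u Xs Gu.
have lJ := letters_layer (size X) (cons_sub sG Gx); have nJ := layer_norm lJ.
have KJ : letters s (size X) \subset letters (x :: s) (size X).
  by apply: lettersS => z zs; rewrite inE zs orbT.
have [o' [k [ao' ->]]] := perp_decomp pG sG Ga (spanG Ga nCa nRa) Gu.
have Go' := subsetP (perp_sub pG sG Ga) o' ao'; have Xr := rev_sub Xs.
have Gak : o' * a ^+ k \in G by rewrite groupM ?groupX.
rewrite (adj Xs lJ KJ) // (commMl nJ) ?groupX //.
  by rewrite (comm_expgl nJ) // -(size_rev X) aa.
by apply: (perp_radical pG sG Ga ao' Xr); rewrite size_rev.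
Qed.

Hypothesis nCG : forall x y, x \in G -> y \in G -> x \notin C -> y \notin C -> x * y \in C.

(** For [z] in [C], both [x * z] and [y * z] stay off [C], so [perp_congruent] puts all pairings of
    [z] into the images of [ad x] and of [ad y], which meet trivially. *)
Lemma perpI_radical x y : x \in G -> y \in G -> x \notin C -> y \notin C ->
    x \notin radicalG s -> y \notin radicalG s -> y \in perp s x ->
    (forall n, letters (x :: s) n :&: letters (y :: s) n \subset letters s n) ->
  perp s x :&: perp s y \subset radicalG s.
Proof.
move=> Gx Gy nCx nCy nRx nRy xy TI.
apply/subsetP=> z /setIP[xz yz]; have Gz := subsetP (perp_sub pG sG Gx) z xz.
have inK n w : w \in letters (x :: s) n -> w \in letters (y :: s) n ->
    w \in lettersPhi s n.
  move=> h1 h2; apply: (subsetP (lettersPhi_ge _ _ _)); apply: (subsetP (TI n)).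
  by rewrite inE h1.
case: (boolP (z \in C)) => Cz.
  apply/(radicalP pG _ sG); split=> // X Xs u Gu.
  have sx := cons_sub sG Gx; have sy := cons_sub sG Gy.
  apply: inK.
    have := perp_congruent Gx nCx nRx xz erefl.
    rewrite (groupMr _ Cz) => /(_ nCx)[_ /(_ X u Xs Gu)].
    rewrite (commMl (layer_norm (letters_layer _ sx))) //.
    by rewrite letters_comm ?mem_head // word_memG.
  have := perp_congruent Gy nCy nRy yz erefl.
  rewrite (groupMr _ Cz) => /(_ nCy)[_ /(_ X u Xs Gu)].
  rewrite (commMl (layer_norm (letters_layer _ sy))) //.
  by rewrite letters_comm ?mem_head // word_memG.
(* For [z] off [C], the product [x * y * z] is off [C] and is a translate of [x], and of [y], by an
   orthogonal element. It would be radical, which [perp_congruent] forbids. *)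
have nCw : x * y * z \notin C by rewrite groupMl // nCG.
have yx := perp_sym pG sG Gx xy.
have ew : x * y * z = y * (x ^ y * z) by rewrite conjgE !mulgA mulgV mul1g.
have xyz : y * z \in perp s x by rewrite groupM.
have yxz : x ^ y * z \in perp s y.
  by rewrite groupM // (memJ_normal (perp_norm pG sG Gy)).
have [/negP nRw hx] := perp_congruent Gx nCx nRx xyz (esym (mulgA x y z)) nCw.
have [_ hy] := perp_congruent Gy nCy nRy yxz ew nCw.
case: nRw; apply/(radicalP pG _ sG); split=> [|X Xs u Gu]; first by rewrite !groupM.
by apply: inK; [apply: hx | apply: hy].
Qed.
End AllFail.

(** * Induction on the graded breadth *)

Section Defect.
Import GroupScope.
Variables (gT : finGroupType) (p : nat) (G : {group gT}).
Hypothesis (p_pr : prime p) (pG : p.-group G).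
Local Notation g n := ('L_n.+1(G)).
Local Notation letters := (letters G).
Local Notation lettersPhi := (lettersPhi G).
Local Notation brank := (brank p G).
Local Notation defect := (defect p G).
Local Notation radicalG := (radicalG G).
Local Notation perp := (perp G).
Implicit Types (x y z u v w : gT) (s : seq gT) (C O : {group gT}).

Lemma notin_translate C x y : x \in G -> x \notin C -> y \in G ->
  exists k, y * x ^+ k \notin C.
Proof.
move=> Gx nCx Gy; case: (boolP (y \in C)) => Cy; last by exists 0; rewrite mulg1.
by exists 1%N; rewrite groupMl.
Qed.

Lemma index2_mulg C x y : maximal C G -> p = 2 -> x \in G -> y \in G ->
  x \notin C -> y \notin C -> x * y \in C.
Proof.
move=> maxC p2 Gx Gy nCx nCy.
have sCG := maxgroupp maxC; have {}sCG := proper_sub sCG.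
have iC : #|G : C| = 2 by rewrite (p_maximal_index pG maxC) p2.
have dis : [disjoint C & x^-1 *: C].
  apply/pred0P=> z /=; apply/negP=> /andP[Cz]; rewrite mem_lcoset invgK => Cxz.
  by case/negP: nCx; rewrite -(groupMr _ Cz).
have: C :|: x^-1 *: C = G.
  apply/eqP; rewrite eqEcard subUset sCG /=; apply/andP; split.
    by apply/subsetP=> z; rewrite mem_lcoset invgK => /(subsetP sCG); rewrite groupMl.
  rewrite cardsU; have := dis; rewrite -setI_eq0 => /eqP->.
  by rewrite cards0 subn0 card_lcoset addnn -muln2 -iC Lagrange.
by move/setP/(_ y); rewrite !inE (negbTE nCy) mem_lcoset invgK Gy.
Qed.

Lemma radicalG_sub s : {subset s <= G} -> radicalG s \subset G.
Proof. by move=> sG; rewrite (radicalGE pG) // radical_sub. Qed.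

Lemma radical_defect0 s ys : {subset s <= G} -> {subset ys <= G} ->
  (forall u, u \in G -> u \in <<radicalG s :|: [set y in ys]>>) ->
  defect (ys ++ s) = 0.
Proof.
move=> sG yG h; apply: radical_full => //; apply/subsetP=> u /h.
by rewrite (radicalGE pG).
Qed.

Lemma brank_bad s x y : {subset s <= G} -> x \in G -> y \in G ->
    brank s y <= brank (x :: s) y ->
  forall n, letters (x :: s) n :&: letters (y :: s) n \subset letters s n.
Proof.
move=> sG Gx Gy le n; apply/subsetP=> w /setIP[wx wy].
apply: contraLR le => ws; rewrite -ltnNge; exact: brank_cons_drop ws.
Qed.

(** Either some letter lowers ranks by one off a proper subgroup, and the induction hypothesis
    applies, or the radical with at most two letters generates [G] and the defect is counted
    directly. *)
Lemma defect_le_ind mu :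
  (forall s C, {subset s <= G} -> C \proper G ->
    (forall y, y \in G -> y \notin C -> brank s y <= mu) ->
      defect s <= 'C(mu.+1, 2) + (p == 2)) ->
  forall s C, {subset s <= G} -> maximal C G ->
    (forall y, y \in G -> y \notin C -> brank s y <= mu.+1) ->
      defect s <= 'C(mu.+2, 2) + (p == 2).
Proof.
move=> IH s C sG maxC rC; have prC := maxgroupp maxC.
have goal x O : x \in G -> x \notin C -> O \proper G ->
    (forall y, y \in G -> y \notin O -> brank (x :: s) y <= mu) ->
    defect s <= 'C(mu.+2, 2) + (p == 2).
  move=> Gx nCx prO hO; rewrite (defect_cons _ (cons_sub sG Gx)).
  have := IH _ O (cons_sub sG Gx) prO hO; have := rC x Gx nCx.
  rewrite (binS mu.+1) bin1; clear; lia.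
have [RG|prR] := eqVproper (radicalG_sub sG).
  have := @radical_defect0 s [::] sG; rewrite /= => -> // u Gu.
  by rewrite mem_gen // inE RG Gu.
have [x [Gx nCx nRx]] := proper_setU_neq prC prR.
case: (boolP [exists a in G, [&& a \notin C, a \notin radicalG s &
                 ~~ (G \subset perp s a <*> <[a]>)]]) => [/existsP[a]|].
  case/and4P=> Ga nCa nRa npa.
  (* Translating [y] by powers of [a] to leave [C] cannot enter [perp s a], since [y] is outside the
     join. *)
  have Oa : perp s a <*> <[a]> \proper G.
    by rewrite properE npa join_subG cycle_subG Ga (perp_sub pG).
  apply: (goal a (perp s a <*> <[a]>)%G Ga nCa Oa) => y Gy ny.
  have [k nk] := notin_translate Ga nCa Gy.
  rewrite -(brank_translate p k sG Ga Gy) -ltnS.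
  have Gk : y * a ^+ k \in G by rewrite groupM ?groupX.
  apply: leq_trans (rC _ Gk nk); apply: (perp_brank p_pr) => //.
  apply: contra ny => yk; rewrite -(mulgK (a ^+ k) y) groupM ?groupV //.
    by apply: (subsetP (joing_subl _ _)).
  by apply: (subsetP (joing_subr _ _)); rewrite mem_cycle.
rewrite negb_exists => /forallP hspan.
have {hspan} spanG a : a \in G -> a \notin C -> a \notin radicalG s ->
    G \subset perp s a <*> <[a]>.
  by move=> Ga nCa nRa; have := hspan a; rewrite Ga nCa nRa /= negbK.
have [p2|pn2] : p = 2 \/ p != 2 by case: (p =P 2); [left | right].
2: {
  have nPx : x \notin perp s x.
    apply/negP=> xx; case/negP: (nRx); have Px : G \subset perp s x.
      apply: subset_trans (spanG x Gx nCx nRx) _.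
      by rewrite join_subG subxx cycle_subG.
    apply/(radicalP pG _ sG); split=> // X Xs u Gu.
    apply: (subsetP (lettersPhi_ge _ _ _)).
    have /(perpP pG _ sG Gx)[_ h] := subsetP Px u Gu.
    rewrite (adjoint0 sG) ?letters_layer // -(size_rev X); apply: h.
    by move=> z; rewrite mem_rev; apply: Xs.
  apply: (goal x C Gx nCx prC) => y Gy nCy.
  have two (H : {group gT}) i j : x \notin H -> i < j <= 2 -> y * x ^+ i \in H ->
      y * x ^+ j \notin H.
    move=> nHx /andP[ltij j2] yi; apply: contra nHx => yj.
    have: x ^+ (j - i) \in H.
      rewrite -(groupMl _ yi) -mulgA -expgD subnKC // ltnW //.
    apply: mem_expg_coprime; have [k ->] := p_natP (mem_p_elt pG Gx).
    apply: coprimeXl; rewrite prime_coprime // gtnNdvd ?subn_gt0 //.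
    rewrite (leq_ltn_trans (leq_trans (leq_subr _ _) j2)) // ltn_neqAle eq_sym pn2.
    exact: prime_gt1.
  (* As [p > 2], each of the two subgroups contains at most one of the three translates with
     [k <= 2]. *)
  have [k [nCk nPk]] : exists k, y * x ^+ k \notin C /\ y * x ^+ k \notin perp s x.
    case: (boolP (y * x ^+ 0 \in C)) => C0.
      case: (boolP (y * x ^+ 1 \in perp s x)) => P1.
        by exists 2; rewrite (two C 0) // (two (perp s x) 1%N).
      by exists 1%N; rewrite (two C 0).
    case: (boolP (y * x ^+ 0 \in perp s x)) => P0; last by exists 0.
    case: (boolP (y * x ^+ 1 \in C)) => C1.
      by exists 2; rewrite (two C 1%N) // (two (perp s x) 0).
    by exists 1%N; rewrite (two (perp s x) 0).
  have Gk : y * x ^+ k \in G by rewrite groupM ?groupX.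
  rewrite -(brank_translate p k sG Gx Gy) -ltnS.
  exact: leq_trans (perp_brank p_pr pG sG Gx Gk nPk) (rC _ Gk nCk). }
have pG2 : 2.-group G by rewrite -p2.
(* A [y] whose rank does not drop has image meeting that of [x] trivially and is orthogonal to [x];
   then [x], [y] and the radical generate [G]. *)
case: (boolP [exists y in G, [&& y \notin C, y \notin radicalG s &
                 brank s y <= brank (x :: s) y]]) => [/existsP[y]|].
  case/and4P=> Gy nCy nRy bady.
  have TI := brank_bad sG Gx Gy bady.
  have xy : y \in perp s x.
    rewrite -(negbK (y \in _)); apply: contraTN bady => nxy.
    by rewrite -ltnNge; apply: (perp_brank p_pr).
  have nCG u v := @index2_mulg C u v maxC p2.
  have sub := perpI_radical pG2 sG spanG nCG Gx Gy nCx nCy nRx nRy xy TI.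
  have D0 : defect ([:: y; x] ++ s) = 0.
    apply: radical_defect0 => //; first by move=> z; rewrite !inE => /orP[]/eqP->.
    have genx : x \in <<radicalG s :|: [set z in [:: y; x]]>>.
      by rewrite mem_gen // !inE eqxx !orbT.
    have geny : y \in <<radicalG s :|: [set z in [:: y; x]]>>.
      by rewrite mem_gen // !inE eqxx !orbT.
    move=> u Gu; have [o [k [xo ->]]] := perp_decomp pG sG Gx (spanG x Gx nCx nRx) Gu.
    have Go := subsetP (perp_sub pG sG Gx) o xo.
    have [o2 [j [yo eo]]] := perp_decomp pG sG Gy (spanG y Gy nCy nRy) Go.
    rewrite groupM ?groupX // eo groupM ?groupX //.
    apply: mem_gen; rewrite inE; apply/orP; left; apply: (subsetP sub).
    rewrite inE yo andbT -(mulgK (y ^+ j) o2) -eo groupM // groupV groupX //.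
  rewrite (defect_cons _ (cons_sub sG Gx)).
  rewrite (defect_cons _ (cons_sub (cons_sub sG Gx) Gy)) D0 addn0.
  (* The defect is at most [2 * mu.+1], which equals the bound for [mu = 0] and [mu = 1]: here the
     extra one for [p = 2] enters. *)
  have := brank_cons_le p sG Gx Gy; have := rC x Gx nCx; have := rC y Gy nCy.
  rewrite p2 eqxx binS bin1 bin2 -divn2; move: (brank s x) (brank s y) (brank (x :: s) y).
  clear; move=> a b c; case: mu => [|m]; nia.
rewrite negb_exists => /forallP good.
have {}good y : y \in G -> y \notin C -> y \notin radicalG s -> brank (x :: s) y <= mu.
  move=> Gy nCy nRy; have := good y; rewrite Gy nCy nRy /= -ltnNge => lt.
  by rewrite -ltnS; apply: leq_trans lt (rC _ Gy nCy).
(* Ranks drop off both [C] and the radical. Joining [x] to the radical gives an exceptional subgroup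
   stable under the translations used to leave [C]. *)
have RxG : radicalG s <*> <[x]> \subset G.
  by rewrite join_subG cycle_subG Gx radicalG_sub.
have [eRx|prRx] := eqVproper RxG.
  have D0 : defect ([:: x] ++ s) = 0.
    apply: radical_defect0 => //; first by move=> z; rewrite inE => /eqP->.
    move=> u; rewrite -eRx; apply: subsetP; rewrite join_subG cycle_subG.
    by rewrite (subset_trans _ (subset_gen _)) ?subsetUl // mem_gen // !inE eqxx orbT.
  rewrite (defect_cons _ (cons_sub sG Gx)) D0 addn0.
  by have := rC x Gx nCx; rewrite binS bin1; clear; lia.
apply: (goal x (radicalG s <*> <[x]>)%G Gx nCx prRx) => y Gy ny.
have [k nk] := notin_translate Gx nCx Gy.
have Gk : y * x ^+ k \in G by rewrite groupM ?groupX.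
rewrite -(brank_translate p k sG Gx Gy); apply: good => //.
apply: contra ny => yk; rewrite -(mulgK (x ^+ k) y) groupM ?groupV //.
  by apply: (subsetP (joing_subl _ _)).
by apply: (subsetP (joing_subr _ _)); rewrite mem_cycle.
Qed.

Lemma maximal_exists_sub C : C \proper G -> exists2 M : {group gT}, maximal M G & C \subset M.
Proof.
move=> prC; have [eC|] := maximal_exists (proper_sub prC); last by case=> M; exists M.
by move: prC; rewrite eC properxx.
Qed.

Theorem defect_le mu s C : {subset s <= G} -> C \proper G ->
    (forall y, y \in G -> y \notin C -> brank s y <= mu) ->
  defect s <= 'C(mu.+1, 2) + (p == 2).
Proof.
elim: mu s C => [|mu IH] s C sG prC rC; last first.
  have [M maxM CM] := maximal_exists_sub prC.
  apply: (defect_le_ind IH sG maxM) => y Gy nMy; apply: rC => //.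
  by apply: contra nMy; apply: (subsetP CM).
(* Rank zero puts every element off [C] into the radical; [G] is not a union of two proper
   subgroups, so the radical is [G]. *)
have [RG|prR] := eqVproper (radicalG_sub sG); last first.
  have [x [Gx nCx]] := proper_setU_neq prC prR; case/negP.
  apply/(radicalP pG _ sG); split=> // X Xs u Gu.
  have r0 : brank s x = 0 by apply/eqP; rewrite -leqn0 rC.
  apply: (subsetP (lettersPhi_ge _ _ _)).
  apply: (subsetP (rank0_letters p_pr pG _ sG Gx r0)).
  rewrite letters_comm ?mem_head // word_mem0 // => z /Xs/sG //.
have := @radical_defect0 s [::] sG; rewrite /= => -> // u Gu.
by rewrite mem_gen // inE RG Gu.
Qed.
End Defect.

(** * Breadth and its graded version *)

Section Breadth.
Import GroupScope.
Variables (gT : finGroupType) (p : nat) (G : {group gT}).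
Hypothesis (p_pr : prime p) (pG : p.-group G).
Local Notation g n := ('L_n.+1(G)).
Local Notation letters := (letters G).
Local Notation brank := (brank p G).
Local Notation defect := (defect p G).
Local Notation breadth := (breadth p G).
Implicit Types (x y z u v w : gT) (s : seq gT).

Lemma sub_nil : {subset [::] <= G}. Proof. by []. Qed.
Lemma sub_seq1 x : x \in G -> {subset [:: x] <= G}.
Proof. exact: cons_sub sub_nil. Qed.

Lemma defect_nil : defect [::] = logn p #|G^`(1)|.
Proof.
have tel m : \sum_(n < m) logn p #|g n.+1 : g n.+2| = logn p #|g 1 : g m.+1|.
  elim: m => [|m IH]; first by rewrite big_ord0 indexgg logn1.
  rewrite big_ord_recr /= IH -lognM // Lagrange_index ?lcn_subS //.
  exact: lcn_sub_leq.
by rewrite [LHS]tel (lcn_eventually_trivial pG (leqnSn _)) indexg1.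
Qed.

(** The preimage in [g n] of the kernel of [ad x] in degree [n + 1]. *)
Definition commuter n x : {set gT} := [set h in g n | [~ x, h] \in g n.+2].

Lemma commuter_group_set n x : x \in G -> group_set (commuter n x).
Proof.
move=> Gx; have nJ : G \subset 'N('L_n.+3(G)) by apply: lcn_norm.
apply/group_setP; split; first by rewrite inE group1 commg1 group1.
move=> a b; rewrite !inE => /andP[ga ha] /andP[gb hb].
by rewrite groupM //= (commMr nJ) ?(lcn_memG gb).
Qed.

(** First isomorphism theorem for [ad x], seen as a morphism from [g n] to [g n.+1 / g n.+2]. *)
Lemma index_letters1 n x : x \in G ->
  #|letters [:: x] n : g n.+2| = #|g n : commuter n x|.
Proof.
move=> Gx; pose N := 'L_n.+3(G)%G; have nN : G \subset 'N(N) by apply: lcn_norm.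
have lL := letters_layer n (sub_seq1 Gx).
have gxh h : h \in g n -> [~ x, h] \in g n.+1.
  by move=> gh; have := @lcn_comm _ G 0 n x h; rewrite add0n; apply; rewrite ?lcn1.
have Nx h : h \in g n -> [~ x, h] \in 'N(N).
  by move=> gh; apply: (subsetP nN); apply: (lcn_memG (gxh _ gh)).
pose f h := coset N [~ x, h].
have gN m u v : u \in g n.+1 -> v \in g m -> [~ u, v] \in N.
  move=> gu gv; have /= := lcn_comm gu gv; apply: lcn_mem.
  by rewrite addSn !ltnS leq_addr.
have swap u v : u \in 'N(N) -> v \in 'N(N) -> [~ v, u] \in N ->
    coset N (v * u) = coset N u * coset N v.
  by move=> Nu Nv vuN; rewrite commgC coset_kerr // morphM.
have fM : {in g n &, {morph f : a b / a * b}}.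
  move=> a b ga gb; rewrite /f commgMJ conjg_mulR mulgA coset_kerr.
    by apply: swap; rewrite ?Nx //; apply: (gN n.+1); apply: gxh.
  by apply: (gN n); rewrite ?gxh.
pose phi := Morphism fM.
have im : phi @* g n = letters [:: x] n / N.
  apply/eqP; rewrite eqEsubset; apply/andP; split.
    apply/subsetP=> _ /morphimP[h gh _ ->]; apply: mem_quotient.
    by rewrite letters_comm ?mem_head.
  rewrite sub_quotient_pre; last exact: subset_trans (letters_subG n (sub_seq1 Gx)) nN.
  apply: (@letters_min _ _ [:: x] n (coset N @*^-1 (phi @* 'L_n.+1(G)))%G) => [|y z].
    by apply: subset_trans (ker_sub_pre _ _); rewrite ker_coset.
  rewrite inE => /eqP-> gz; rewrite mem_morphpre ?Nx //.
  exact: (mem_morphim phi gz gz).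
have nNL : N <| letters [:: x] n.
  rewrite /normal letters_ge; exact: subset_trans (letters_subG n (sub_seq1 Gx)) nN.
rewrite -card_quotient ?normal_norm // -im card_morphim setIid; congr #|_ : _|.
apply/setP=> h; rewrite !inE; case gh: (h \in g n) => //=.
apply/eqP/idP => [|/coset_id //]; apply: coset_idr; exact: Nx.
Qed.
End Breadth.

(** * Elements whose breadth is attained in the graded ring *)

Section Lift.
Import GroupScope.
Variables (gT : finGroupType) (p : nat) (G : {group gT}).
Hypothesis (p_pr : prime p) (pG : p.-group G).
Local Notation g n := ('L_n.+1(G)).
Local Notation letters := (letters G).
Local Notation brank := (brank p G).
Local Notation defect := (defect p G).
Local Notation breadth := (breadth p G).
Local Notation commuter := (commuter G).
Local Notation cent n x := ('C_('L_n.+1(G))[x]).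
Implicit Types (x y z u v w : gT) (s : seq gT).

Lemma cent_join n x : cent n x <*> g n.+1 = cent n x * g n.+1.
Proof.
apply: norm_joinEl; apply: subset_trans (lcn_norm _ _).
by rewrite subIset // lcn_sub.
Qed.

Lemma breadth_sum x : x \in G ->
  breadth x = \sum_(n < #|G|) logn p #|g n : cent n x <*> g n.+1|.
Proof.
move=> Gx.
have step n : logn p #|g n : cent n x| =
    (logn p #|g n : cent n x <*> g n.+1| + logn p #|g n.+1 : cent n.+1 x|)%N.
  have sub : cent n x <*> g n.+1 \subset g n by rewrite join_subG subsetIl lcn_subS.
  have e : #|cent n x <*> g n.+1 : cent n x| = #|g n.+1 : cent n.+1 x|.
    rewrite cent_join indexMg -indexgI; congr #|_ : _|.
    by rewrite setIA (setIidPl (lcn_subS _ _)).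
  by rewrite -e -lognM // (Lagrange_index sub) // joing_subl.
have tel m : logn p #|g 0 : cent 0 x| =
    (\sum_(n < m) logn p #|g n : cent n x <*> g n.+1| + logn p #|g m : cent m x|)%N.
  elim: m => [|m IH]; first by rewrite big_ord0.
  by rewrite big_ord_recr /= -addnA -step.
rewrite /breadth; have := tel #|G|; rewrite (lcn_eventually_trivial pG (leqnn _)).
by rewrite set1gE (setIidPl (sub1G _)) indexgg logn1 addn0.
Qed.

Lemma cent_commuter n x : x \in G -> cent n x <*> g n.+1 \subset commuter n x.
Proof.
move=> Gx; rewrite -[commuter n x](gen_set_id (commuter_group_set n Gx)).
rewrite join_subG; apply/andP; split; apply: subset_trans (subset_gen _).
  apply/subsetP=> h /setIP[gh /cent1P xh]; rewrite inE gh.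
  by rewrite (eqP (introT commgP (esym xh))) group1.
apply/subsetP=> h gh; rewrite inE (lcn_mem (leqnSn _) gh) /=.
by have := @lcn_comm _ G 0 n.+1 x h; rewrite add0n; apply; rewrite ?lcn1.
Qed.

(** In each degree, breadth exceeds graded breadth by the part of the kernel of [ad x] not
    represented by true centralizing elements. *)
Lemma brank_nil_term n x : x \in G ->
  (logn p #|letters [:: x] n : letters [::] n| +
     logn p #|commuter n x : cent n x <*> g n.+1|)%N
  = logn p #|g n : cent n x <*> g n.+1|.
Proof.
move=> Gx; rewrite [X in (X + _)%N](congr1 (logn p) (index_letters1 n Gx)).
have eK := gen_set_id (commuter_group_set n Gx).
have sub : <<commuter n x>> \subset g n.
  by rewrite eK; apply/subsetP=> h; rewrite inE => /andP[].
have sub' : cent n x <*> 'L_n.+2(G) \subset <<commuter n x>>.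
  by rewrite eK cent_commuter.
have := Lagrange_index sub sub'; rewrite /= eK => <-.
by rewrite lognM // -eK.
Qed.

Lemma brank_le_breadth x : x \in G -> brank [::] x <= breadth x.
Proof.
move=> Gx; rewrite breadth_sum //; apply: leq_sum => n _.
by rewrite -(brank_nil_term n Gx) leq_addr.
Qed.

(* Equality of breadth and graded breadth means that everything commuting with [x]
   to leading order is the leading term of a true centralizer. *)
Lemma exact_commuter n x h : x \in G -> breadth x <= brank [::] x ->
  h \in commuter n x -> exists c k, [/\ c \in 'C_G[x], k \in g n.+1 & h = c * k].
Proof.
move=> Gx le hK; suff: h \in cent n x <*> g n.+1.
  rewrite cent_join => /mulsgP[c k /setIP[/lcn_memG Gc cx] gk ->].
  by exists c, k; rewrite inE Gc.
case: (ltnP n #|G|) => [ltn|leG]; last first.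
  move: hK; rewrite inE (lcn_eventually_trivial pG leG) => /andP[/set1P-> _].
  exact: group1.
have eK := gen_set_id (commuter_group_set n Gx).
have iP : p.-nat #|<<commuter n x>> : cent n x <*> g n.+1|.
  have sub : <<commuter n x>> \subset G.
    by rewrite eK; apply/subsetP=> u; rewrite inE => /andP[/lcn_memG].
  exact: pnat_dvd (dvdn_indexg _ _) (pgroupS sub pG).
have [k ik] := p_natP iP.
suff k0 : k = 0.
  have /eqP := ik; rewrite k0 expn0 indexg_eq1 => /subsetP/(_ h) /=.
  by rewrite eK; apply.
apply/eqP; rewrite -leqn0; have := brank_nil_term n Gx.
rewrite -{1}eK ik lognX (logn_prime p p_pr) eqxx muln1 => e.
move: le; rewrite breadth_sum // /brank.
rewrite (bigD1 (Ordinal ltn)) //= [X in _ <= X](bigD1 (Ordinal ltn)) //= -e.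
set S1 := \sum_(i < _ | _) _; set S2 := \sum_(i < _ | _) _.
have: S2 <= S1 by apply: leq_sum => i _; rewrite -(brank_nil_term i Gx) leq_addr.
move: (logn _ _) => L; clear; lia.
Qed.

(** While [[~ w, h]] is deeper than [h] predicts, [exact_commuter] strips a centralizing factor from
    [h], moving it one term down without changing the commutator. *)
Lemma exact_leading n w h : w \in G -> breadth w <= brank [::] w -> h \in G ->
  [~ w, h] \in g n.+1 -> [~ w, h] \in letters [:: w] n.
Proof.
move=> Gw ex Gh gwh.
suff H i : i <= n -> exists2 h', h' \in g i & [~ w, h] = [~ w, h'].
  by have [h' gh' ->] := H n (leqnn _); rewrite letters_comm ?mem_head.
elim: i => [|i IH] lein; first by exists h; rewrite ?lcn1.
have [h' gh' e] := IH (ltnW lein).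
have: h' \in commuter i w.
  by rewrite inE gh' -e (lcn_mem _ gwh) // ltnS.
case/(exact_commuter Gw ex)=> c [k [/setIP[Gc /cent1P cw] gk eh]].
exists k => //; rewrite e eh commgMJ (eqP (introT commgP (esym cw))).
by rewrite conj1g mulg1.
Qed.

Lemma letters_derived z y n : z \in G -> y \in g 1 ->
  letters [:: z * y] n = letters [:: z] n.
Proof.
move=> Gz gy; have Gy := lcn_memG gy.
have aux a b : a \in G -> b \in g 1 -> letters [:: a * b] n \subset letters [:: a] n.
  move=> Ga gb; have lJ := letters_layer n (sub_seq1 Ga).
  apply: letters_min => [|x v]; first by case/andP: lJ.
  rewrite inE => /eqP-> gv.
  have lJ' : layer G (0 + n).+1 (letters [:: a] n) by rewrite add0n.
  by rewrite (layer_congl lJ') // letters_comm ?mem_head.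
apply/val_inj/eqP; rewrite eqEsubset aux //=.
by rewrite -{1}(mulgK y z) aux ?groupM ?groupV.
Qed.

(* If [z] already attains its breadth on the associated graded ring, then all its
   translates by [g 1] have the same leading terms; compare [z] with [z * y]. *)
Lemma lift_derived z c y j : z \in G -> breadth z <= brank [::] z ->
    (forall y, y \in g 1 -> breadth (z * y) <= brank [::] z) ->
    c \in commuter 0 z -> 0 < j -> y \in g j -> [~ y, c] \in letters [:: z] j.
Proof.
move=> Gz exz mz cz j0 gy; have gy1 : y \in g 1 by apply: lcn_mem gy.
have Gy := lcn_memG gy.
have [c0 [h [/setIP[Gc0 /cent1P c0z] gh ->]]] := exact_commuter Gz exz cz.
have lJ := letters_layer j (sub_seq1 Gz); have nJ := layer_norm lJ.
have rzy : brank [::] (z * y) = brank [::] z.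
  by apply: eq_bigr => n _; rewrite (letters_derived _ Gz gy1).
have yh : [~ y, h] \in letters [:: z] j.
  have /andP[/subsetP sub _] := lJ; apply: sub.
  by have := lcn_comm gy gh; rewrite addn1.
rewrite (commMr' nJ) ?(lcn_memG gh) //.
(* Since [c0] centralizes [z], exactness of [z * y] applies to [[~ y, c0]]. *)
have e : [~ z * y, c0] = [~ y, c0].
  by rewrite commMgJ (eqP (introT commgP (esym c0z))) conj1g mul1g.
rewrite -e -(letters_derived j Gz gy1); apply: exact_leading => //; first exact: groupM.
  by rewrite rzy mz.
by rewrite e; have := @lcn_comm _ G j 0 y c0; rewrite addn0; apply; rewrite ?lcn1.
Qed.

End Lift.

(** * Avoiding subgroups and the greedy choice *)

Section Avoid.
Import GroupScope.
Variables (gT : finGroupType) (p : nat) (G : {group gT}).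
Hypothesis (p_pr : prime p) (pG : p.-group G).
Implicit Types (x y : gT) (Hs : seq {group gT}).

Definition avoids Hs x := all (fun H : {group gT} => x \notin H) Hs.

(** Pigeonhole: if all [p] translates met the fewer than [p] subgroups, two would lie in the same
    one, which would then contain [x]. *)
Lemma avoids_translate Hs x y : size Hs < p -> x \in G -> avoids Hs x ->
  exists k, avoids Hs (y * x ^+ k).
Proof.
move=> ltHp Gx /allP nx.
case: (boolP [exists k : 'I_p, avoids Hs (y * x ^+ k)]) => [/existsP[k]|].
  by exists k.
rewrite negb_exists => /forallP bad.
pose f (k : 'I_p) := find (fun H : {group gT} => y * x ^+ k \in H) Hs.
have ltf k : f k < size Hs.
  rewrite -has_find; have := bad k; rewrite -has_predC.
  by apply: sub_has => H /=; rewrite negbK.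
pose F (k : 'I_p) : 'I_(size Hs) := Ordinal (ltf k).
have /injectivePn[k1 [k2 ne eF]] : ~~ injectiveb F.
  apply: contraL ltHp => /injectiveP/leq_card; rewrite !card_ord -leqNgt //.
wlog lt12 : k1 k2 ne eF / k1 < k2.
  move=> W; case: (ltngtP k1 k2) => [|lt21|/val_inj e]; first exact: W.
    by apply: (W k2 k1) => //; rewrite eq_sym.
  by rewrite e eqxx in ne.
set H := nth 1%G Hs (f k1).
have inH k : f k = f k1 -> y * x ^+ k \in H.
  move=> e; rewrite /H -e; have hh : has (fun H : {group gT} => y * x ^+ k \in H) Hs.
    by rewrite has_find ltf.
  exact: (nth_find 1%G hh).
have: x \in H.
  apply: (@mem_expg_coprime _ _ _ (k2 - k1)).
    have [k ->] := p_natP (mem_p_elt pG Gx).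
    apply: coprimeXl; rewrite prime_coprime // gtnNdvd ?subn_gt0 //.
    exact: leq_ltn_trans (leq_subr _ _) (ltn_ord k2).
  rewrite -(groupMl _ (inH k1 erefl)) -mulgA -expgD subnKC; last exact: ltnW.
  by apply: inH; have /(congr1 val) := eF.
by rewrite (negbTE (nx H _)) // mem_nth.
Qed.

(** Allowing [p] subgroups leaves room for one beyond the given [p - 1]. *)
Lemma avoids_exists Hs : size Hs <= p -> all (fun H : {group gT} => H \proper G) Hs ->
  exists2 x, x \in G & avoids Hs x.
Proof.
elim: Hs => [|H Hs IH] /= ltHp; first by exists 1.
case/andP=> /properP[_ [y Gy nHy]] prHs; have [x Gx ax] := IH (ltnW ltHp) prHs.
case: (boolP (x \in H)) => Hx; last by exists x; rewrite //= Hx.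
have [k ak] := avoids_translate y ltHp Gx ax.
exists (y * x ^+ k); first by rewrite groupM ?groupX.
by apply/andP; split=> //; rewrite groupMr ?groupX.
Qed.
End Avoid.

(** * The degree-two bound and the first letter *)

Section Bound.
Import GroupScope.
Variables (gT : finGroupType) (p : nat) (G : {group gT}).
Hypothesis (p_pr : prime p) (pG : p.-group G).
Local Notation g n := ('L_n.+1(G)).
Local Notation letters := (letters G).
Local Notation brank := (brank p G).
Local Notation defect := (defect p G).
Local Notation breadth := (breadth p G).
Local Notation commuter := (commuter G).
Local Notation term s y n := (logn p #|letters (y :: s) n : letters s n|).
Implicit Types (x y z u v w : gT) (s : seq gT) (C Q : {group gT}).

Lemma letters_drop0 s x y k : {subset s <= G} -> x \in G -> y \in G ->
  [~ y, x] \notin letters s 0 -> term (x :: s) y 0 < term s (y * x ^+ k) 0.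
Proof.
move=> sG Gx Gy nyx; have Gk : y * x ^+ k \in G by rewrite groupM ?groupX.
rewrite -(letters_translate k 0 (cons_sub sG Gx) (mem_head _ _) Gy).
apply: (letters_index_drop p_pr pG (w := [~ y * x ^+ k, x])) => //.
- by rewrite comm_memC letters_comm ?mem_head // lcn1.
- by rewrite letters_comm ?mem_head // lcn1.
rewrite (commMl' (layer_norm (letters_layer 0 sG))) ?groupX //.
have -> : [~ x ^+ k, x] = 1 by apply/eqP/commgP; apply/commute_sym/commuteX.
exact: group1.
Qed.

Lemma centralizer_mod (J : {group gT}) : G \subset 'N(J) ->
  exists Z : {group gT}, forall z,
    (z \in Z) = (z \in G) && [forall h in G, [~ z, h] \in J].
Proof.
move=> nJ; have gP : group_set [set z in G | [forall h in G, [~ z, h] \in J]].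
  apply/group_setP; split.
    by rewrite inE group1; apply/forall_inP=> h _; rewrite comm1g group1.
  move=> a b; rewrite !inE => /andP[Ga /forall_inP aJ] /andP[Gb /forall_inP bJ].
  by rewrite groupM //=; apply/forall_inP=> h Gh; rewrite (commMl nJ) ?aJ ?bJ.
by exists (Group gP) => z; rewrite inE.
Qed.

(** In degree two the pairing is alternating: translating [y] by [x ^+ k] preserves [[~ y, x]]
    modulo letters. Hence no stuck case arises, even for [p = 2]. *)
Lemma class2_le mu s C : {subset s <= G} -> C \proper G ->
    (forall y, y \in G -> y \notin C -> term s y 0 <= mu) ->
  logn p #|g 1 : letters s 0| <= 'C(mu.+1, 2).
Proof.
elim: mu s C => [|mu IH] s C sG prC rC.
all: have nK := layer_norm (letters_layer 0 sG); have [Z ZE] := centralizer_mod nK.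
all: have ZG : Z \subset G by apply/subsetP=> z; rewrite ZE => /andP[].
all: have [GZ|prZ] := eqVproper ZG.
1, 3: suff -> : #|g 1 : letters s 0| = 1%N by rewrite logn1.
1, 2: apply/eqP; rewrite indexg_eq1 /= lcnSn gen_subG.
1, 2: apply/subsetP=> _ /imset2P[z h + Gh ->]; rewrite lcn1 -{1}GZ ZE.
1, 2: by case/andP=> _ /forall_inP->.
all: have [x [Gx nCx nZx]] := proper_setU_neq prC prZ.
  case/negP: nZx; rewrite ZE Gx; apply/forall_inP=> h Gh.
  have := rC x Gx nCx; rewrite leqn0.
  have iP : p.-nat #|letters (x :: s) 0 : letters s 0|.
    exact: pnat_dvd (dvdn_indexg _ _) (letters_pgroup pG 0 (cons_sub sG Gx)).
  have [k ik] := p_natP iP; rewrite ik lognX (logn_prime p p_pr) eqxx muln1 => /eqP k0.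
  move/eqP: ik; rewrite k0 expn0 indexg_eq1 => /subsetP; apply.
  by rewrite letters_comm ?mem_head // lcn1.
have [C' C'E] := comm_kernel nK x.
have prC' : C' \proper G.
  rewrite properE; apply/andP; split; first by apply/subsetP=> z; rewrite C'E => /andP[].
  apply: contra nZx => /subsetP sub; rewrite ZE Gx; apply/forall_inP=> h Gh.
  by have := sub h Gh; rewrite C'E comm_memC => /andP[].
have sub : letters s 0 \subset letters (x :: s) 0.
  by apply: lettersS => z zs; rewrite inE zs orbT.
have /andP[_ sub1] := letters_layer 0 (cons_sub sG Gx).
rewrite -(Lagrange_index sub1 sub) lognM // binS bin1 leq_add ?rC //.
apply: (IH _ C' (cons_sub sG Gx) prC') => y Gy; rewrite C'E Gy /= => nyx.
have [k nCk] := notin_translate Gx nCx Gy.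
rewrite -ltnS; apply: leq_trans (letters_drop0 k sG Gx Gy nyx) _.
by apply: rC => //; rewrite groupM ?groupX.
Qed.

Lemma commuter_sub x : commuter 0 x \subset G.
Proof. by apply/subsetP=> h; rewrite inE lcn1 => /andP[]. Qed.

Lemma commuterP x h : h \in G -> (h \in commuter 0 x) = ([~ x, h] \in letters [::] 0).
Proof. by move=> Gh; rewrite inE lcn1 Gh. Qed.

(** One letter trades the family [Hs] for the single subgroup [commuter 0 x]: translating by [x] to
    avoid [Hs] keeps [y] noncommuting with [x]. Then [defect_le] applies with [m - 1]. *)
Lemma first_step m (Hs : seq {group gT}) x : size Hs < p ->
    (forall y, y \in G -> avoids Hs y -> breadth y <= m) ->
    x \in G -> avoids Hs x -> ~~ (G \subset commuter 0 x) ->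
  defect [::] <= brank [::] x + 'C(m, 2) + (p == 2).
Proof.
move=> ltHp hb Gx ax ncx; have eK := gen_set_id (commuter_group_set 0 Gx).
have prK : <<commuter 0 x>> \proper G by rewrite eK properE commuter_sub.
have sG := sub_seq1 Gx.
have drop y : y \in G -> y \notin commuter 0 x -> brank [:: x] y < m.
  move=> Gy; rewrite commuterP // => nxy; have [k ak] := avoids_translate p_pr pG y ltHp Gx ax.
  have Gk : y * x ^+ k \in G by rewrite groupM ?groupX.
  have nK := layer_norm (letters_layer 0 (sub_nil G)).
  rewrite -(brank_translate p k (sub_nil G) Gx Gy).
  apply: leq_trans (leq_trans (brank_le_breadth pG Gk) (hb _ Gk ak)).
  apply: (brank_cons_drop p_pr pG (sub_nil G) Gx Gk (n := 0) (w := [~ y * x ^+ k, x])).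
  - by rewrite comm_memC letters_comm ?mem_head // lcn1.
  - by rewrite letters_comm ?mem_head // lcn1.
  rewrite (commMl' nK) ?groupX //; first by rewrite comm_memC.
  have -> : [~ x ^+ k, x] = 1 by apply/eqP/commgP; apply/commute_sym/commuteX.
  exact: group1.
have [y Gy ny] := subsetPn ncx; have m0 : 0 < m := leq_ltn_trans (leq0n _) (drop y Gy ny).
rewrite (defect_cons _ sG) -addnA leq_add2l -[m in 'C(m, 2)](prednK m0).
apply: (defect_le p_pr pG (C := <<commuter 0 x>>%G) sG) => // z Gz.
by rewrite /= eK => nz; rewrite -ltnS (prednK m0) drop.
Qed.

(** Degree two, the summand [n = 0], is split off because [class2_le] bounds it separately. *)
Definition defect_tail s := \sum_(n < #|G| | 0 < n) logn p #|g n.+1 : letters s n|.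
Definition brank_tail s x := \sum_(n < #|G| | 0 < n) term s x n.

Lemma defect_head s : defect s = (logn p #|g 1 : letters s 0| + defect_tail s)%N.
Proof.
rewrite /defect (bigD1 (Ordinal (cardG_gt0 G))) //=; congr (_ + _)%N.
by apply: eq_bigl => i; rewrite lt0n.
Qed.

Lemma brank_head s x : brank s x = (term s x 0 + brank_tail s x)%N.
Proof.
rewrite /brank (bigD1 (Ordinal (cardG_gt0 G))) //=; congr (_ + _)%N.
by apply: eq_bigl => i; rewrite lt0n.
Qed.

Lemma term_nil s x n : {subset s <= G} -> x \in G -> term s x n <= term [::] x n.
Proof.
elim: s => // z s IH sG Gx.
have [Gz sG'] : z \in G /\ {subset s <= G}.
  by split=> [|y ys]; apply: sG; rewrite inE ?eqxx // ys orbT.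
by apply: leq_trans (IH sG' Gx); rewrite -(brank_term_drop p n sG' Gz Gx) leq_addr.
Qed.

Lemma defect_tail_cons s x : {subset s <= G} -> x \in G ->
  defect_tail s <= brank_tail [::] x + defect_tail (x :: s).
Proof.
move=> sG Gx; rewrite /defect_tail /brank_tail -big_split; apply: leq_sum => n _ /=.
have /andP[_ sub] := letters_layer n (cons_sub sG Gx).
have sub' : letters s n \subset letters (x :: s) n.
  by apply: lettersS => y ys; rewrite inE ys orbT.
rewrite -(Lagrange_index sub sub') lognM // addnC leq_add2r; exact: term_nil.
Qed.

Lemma logn_index_lt (A B : {group gT}) : A \proper B -> B \subset G ->
  logn p #|G : B| < logn p #|G : A|.
Proof.
move=> prAB BG; have AB := proper_sub prAB.
rewrite -(Lagrange_index BG AB) lognM // -addn1 leq_add2l.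
have iP : p.-nat #|B : A| by apply: pnat_dvd (dvdn_indexg _ _) (pgroupS BG pG).
have [k ik] := p_natP iP; rewrite ik lognX (logn_prime p p_pr) eqxx muln1 lt0n.
apply/eqP=> k0; move/eqP: ik; rewrite k0 expn0 indexg_eq1.
by rewrite (negbTE (proper_subn prAB)).
Qed.

Lemma bin2_add (a v d : nat) : a <= v -> 'C(v, 2) + a * d <= 'C(v + d, 2).
Proof.
move=> le_av; elim: d => [|d IH]; first by rewrite muln0 !addn0.
rewrite addnS binS bin1 mulnS; apply: leq_trans (leq_add IH (leq_trans le_av (leq_addr d v))).
by rewrite -addnA leq_add2l addnC.
Qed.

(** Raising [v'] to [v] removes [a * (v - v')] from the product, and the binomial gains at least as
    much because [a <= v']. This pays for one greedy choice. *)
Lemma bin2_trade (a q v v' m : nat) : a <= v' -> a <= q -> v' <= v -> v <= m ->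
  'C(v', 2) + a * (m - v') <= 'C(v, 2) + q * (m - v).
Proof.
move=> av aq vv vm; have := bin2_add (v - v') av; rewrite subnKC // => h.
have -> : (m - v' = (v - v') + (m - v))%N by clear -vv vm; lia.
by rewrite mulnDr addnA leq_add // leq_mul.
Qed.
End Bound.

(** * Greedy choice of letters when graded breadth is maximal *)

Section Greedy.
Import GroupScope.
Variables (gT : finGroupType) (p : nat) (G C : {group gT}) (m : nat).
Hypothesis (p_pr : prime p) (pG : p.-group G).
Local Notation g n := ('L_n.+1(G)).
Local Notation letters := (letters G).
Local Notation brank := (brank p G).
Local Notation defect := (defect p G).
Local Notation breadth := (breadth p G).
Local Notation commuter := (commuter G).
Local Notation term s y n := (logn p #|letters (y :: s) n : letters s n|).
Local Notation r u := (term [::] u 0).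
Implicit Types (x y z u w : gT) (s : seq gT) (Q : {group gT}).

Hypothesis prC : C \proper G.
Hypothesis derC : g 1 \subset C.
Hypothesis breadthC : forall y, y \in G -> y \notin C -> breadth y <= m.
Hypothesis rankC : forall y, y \in G -> y \notin C -> ~~ (G \subset commuter 0 y) ->
  m <= brank [::] y.

Lemma head_index y : y \in G -> r y = logn p #|G : commuter 0 y|.
Proof. by move=> Gy; rewrite (index_letters1 0 Gy) lcn1. Qed.

Lemma tail_le y : y \in G -> y \notin C -> brank_tail p G [::] y <= m - r y.
Proof.
move=> Gy nCy; have := leq_trans (brank_le_breadth pG Gy) (breadthC Gy nCy).
rewrite brank_head => h; rewrite leq_subRL //; exact: leq_trans (leq_addr _ _) h.
Qed.

Lemma commuter_lift z c y j : z \in G -> z \notin C -> ~~ (G \subset commuter 0 z) ->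
  c \in commuter 0 z -> 0 < j -> y \in g j -> [~ y, c] \in letters [:: z] j.
Proof.
move=> Gz nCz ncz; have h := rankC Gz nCz ncz.
apply: (lift_derived p_pr pG Gz (leq_trans (breadthC Gz nCz) h)) => y' gy'.
apply: leq_trans h; apply: breadthC; first by rewrite groupM // (lcn_memG gy').
by rewrite groupMr // (subsetP derC).
Qed.

Variable z0 : gT.
Hypothesis (Gz0 : z0 \in G) (nCz0 : z0 \notin C) (ncz0 : ~~ (G \subset commuter 0 z0)).

(** The letter [z0] brings degree-two ranks off [Q] below [v], so [class2_le] applies with
    [v - 1]. *)
Lemma head_bound Q v : Q \proper G -> commuter 0 z0 \subset Q -> 0 < v ->
    (forall u, u \in G -> u \notin C -> u \notin Q -> r u <= v) ->
  logn p #|g 1 : g 2| <= r z0 + 'C(v, 2).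
Proof.
move=> prQ sKQ v0 hr; have sG := sub_seq1 Gz0.
have /andP[_ sub1] := letters_layer 0 sG.
have sub : letters [::] 0 \subset letters [:: z0] 0 by apply: lettersS.
have e := Lagrange_index sub1 sub.
rewrite -[X in logn p X]e lognM // addnC leq_add2l -(prednK v0).
apply: (class2_le p_pr pG sG prQ) => y Gy nQy.
have [k nCk] := notin_translate Gz0 nCz0 Gy.
have Qz0 : z0 \in Q.
  by apply: (subsetP sKQ); rewrite commuterP // commgg group1.
have nyz : [~ y, z0] \notin letters [::] 0.
  by rewrite comm_memC -commuterP //; apply: contra nQy; apply: (subsetP sKQ).
rewrite -ltnS (prednK v0); apply: leq_trans (letters_drop0 p_pr pG k (sub_nil G) Gz0 Gy nyz) _.
by apply: hr => //; [rewrite groupM ?groupX | rewrite groupMr ?groupX].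
Qed.

(* The picked element [u] maximizes [r]; both [u] and [z0] shrink the index of the
   new [Q], so that index stays below [r u]. *)
Lemma greedy q v Q s : {subset s <= G} -> Q \proper G -> commuter 0 z0 \subset Q ->
    (forall c j y, c \in Q -> 0 < j -> y \in g j -> [~ y, c] \in letters s j) ->
    logn p #|G : Q| = q -> v <= m ->
    (forall u, u \in G -> u \notin C -> u \notin Q -> r u <= v) ->
  logn p #|g 1 : g 2| + defect_tail p G s <= r z0 + ('C(v, 2) + q * (m - v)).
Proof.
elim/ltn_ind: q v Q s => q IH v Q s sG prQ sKQ lift eq vm hr.
have [u0 [Gu0 nCu0 nQu0]] := proper_setU_neq prC prQ.
pose P u := [&& u \in G, u \notin C & u \notin Q].
have Pu0 : P u0 by apply/and3P.
case: (@arg_maxnP _ u0 P (fun u => r u) Pu0) => u /and3P[Gu nCu nQu] umax.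
have {umax} umax w : w \in G -> w \notin C -> w \notin Q -> r w <= r u.
  by move=> Gw nCw nQw; apply: umax; apply/and3P.
have uv : r u <= v by apply: hr.
have nuz : z0 \notin commuter 0 u.
  apply: contra nQu; rewrite commuterP // comm_memC -commuterP //.
  exact: (subsetP sKQ).
have ncu : ~~ (G \subset commuter 0 u).
  by apply: contra nuz => /subsetP; apply.
have eK := gen_set_id (commuter_group_set 0 Gu).
pose K := <<commuter 0 u>>%G; pose Q' := (Q <*> K)%G.
have KE : K = commuter 0 u :> {set gT} by [].
have QG := proper_sub prQ.
have KG : K \subset G by rewrite KE commuter_sub.
have Q'G : Q' \subset G by rewrite join_subG QG.
have Qz0 : z0 \in Q.
  by apply: (subsetP sKQ); rewrite commuterP // commgg group1.
have prQQ' : Q \proper Q'.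
  rewrite properE joing_subl /=; apply: contra nQu => /subsetP; apply.
  by apply: (subsetP (joing_subr _ _)); rewrite KE commuterP // commgg group1.
have prKQ' : K \proper Q'.
  rewrite properE joing_subr /=; apply: contra nuz => /subsetP/(_ z0).
  by rewrite KE; apply; apply: (subsetP (joing_subl _ _)).
have q'q := logn_index_lt p_pr pG prQQ' Q'G; rewrite eq in q'q.
have := logn_index_lt p_pr pG prKQ' Q'G; rewrite KE -(head_index Gu) => q'u.
have ru0 : 0 < r u := leq_ltn_trans (leq0n _) q'u.
have usG := cons_sub sG Gu.
have lift' c j y : c \in Q' -> 0 < j -> y \in g j -> [~ y, c] \in letters (u :: s) j.
  move=> Qc j0 gy; rewrite comm_memC.
  apply: (comm_gen (layer_norm (letters_layer j usG)) _ _ Qc).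
    by rewrite subUset QG.
  move=> d /setUP[Qd|]; rewrite comm_memC.
    suff /subsetP: letters s j \subset letters (u :: s) j by apply; apply: lift.
    by apply: lettersS => w ws; rewrite inE ws orbT.
  rewrite KE => Kd.
  suff /subsetP: letters [:: u] j \subset letters (u :: s) j.
    by apply; apply: commuter_lift.
  by apply: lettersS => w; rewrite !inE => ->.
have step := leq_trans (defect_tail_cons p sG Gu) (leq_add (tail_le Gu nCu) (leqnn _)).
set q' := logn p #|G : Q'| in q'q q'u.
have done1 : logn p #|g 1 : g 2| + defect_tail p G (u :: s)
    <= r z0 + ('C(r u, 2) + q' * (m - r u)).
  (* Once [Q'] is [G], the letters span every degree beyond two, and only the degree-two part
     remains. *)
  have [eQ'|prQ'] := eqVproper Q'G; last first.
    apply: (IH q' q'q (r u) Q' (u :: s) usG prQ' _ lift' erefl (leq_trans uv vm)).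
      exact: subset_trans sKQ (joing_subl _ _).
    move=> w Gw nCw nQ'w; apply: umax => //; apply: contra nQ'w.
    exact: (subsetP (joing_subl _ _)).
  have -> : defect_tail p G (u :: s) = 0.
    rewrite /defect_tail big1 // => -[n ltn] /= n0.
    suff -> : #|g n.+1 : letters (u :: s) n| = 1%N by rewrite logn1.
    suff h : [~: g n, G] \subset letters (u :: s) n by apply/eqP; rewrite indexg_eq1.
    rewrite gen_subG; apply/subsetP=> _ /imset2P[y c gy Gc ->]; apply: lift' => //.
    by have := Gc; rewrite -{1}eQ'.
  rewrite addn0 addnA; apply: leq_trans (leq_addr _ _).
  exact: head_bound ru0 umax.
(* The letter [u] costs [m - r u], turning the factor [q'] into [q'.+1], which is at most [q] and at
   most [r u]. *)
have trade := @bin2_trade q'.+1 q v (r u) m q'u q'q uv vm.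
apply: leq_trans (leq_add (leqnn _) step) _.
rewrite addnCA; apply: leq_trans (leq_add (leqnn _) done1) _.
rewrite addnCA leq_add2l; apply: leq_trans trade.
by rewrite addnCA -mulSn.
Qed.
End Greedy.

Section Main.
Import GroupScope.
Variables (gT : finGroupType) (p : nat) (G C : {group gT}) (m : nat).
Hypothesis (p_pr : prime p) (pG : p.-group G).
Local Notation commuter := (commuter G).
Local Notation r u := (logn p #|letters G [:: u] 0 : letters G [::] 0|).

(** [greedy] starts at a [z] of maximal [r z], with [q = v = r z]; the total is
    [m + 'C(r z, 2) + r z * (m - r z)], at most [m + 'C(m, 2)]. *)
Lemma exact_defect_le : C \proper G -> 'L_2(G) \subset C ->
    (forall y, y \in G -> y \notin C -> breadth p G y <= m) ->
    (forall y, y \in G -> y \notin C -> ~~ (G \subset commuter 0 y) ->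
      m <= brank p G [::] y) ->
    (exists2 y, y \in G & (y \notin C) && ~~ (G \subset commuter 0 y)) ->
  defect p G [::] <= 'C(m.+1, 2).
Proof.
move=> prC derC hb hr [y0 Gy0 /andP[nCy0 ncy0]].
pose P u := [&& u \in G, u \notin C & ~~ (G \subset commuter 0 u)].
have Py0 : P y0 by apply/and3P.
case: (@arg_maxnP _ y0 P (fun u => r u) Py0) => z /and3P[Gz nCz ncz] zmax.
have rm : r z <= m.
  apply: leq_trans (hb z Gz nCz); apply: leq_trans (brank_le_breadth pG Gz).
  by rewrite brank_head leq_addr.
have eK := gen_set_id (commuter_group_set 0 Gz).
have KE : <<commuter 0 z>>%G = commuter 0 z :> {set gT} by [].
have prK : <<commuter 0 z>> \proper G by rewrite eK properE commuter_sub.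
have memK w : (w \in <<commuter 0 z>>%G) = (w \in commuter 0 z).
  by rewrite -[in RHS]KE.
have lift c j y : c \in <<commuter 0 z>>%G -> 0 < j -> y \in 'L_j.+1(G) ->
    [~ y, c] \in letters G [:: z] j.
  rewrite memK.
  exact: (commuter_lift p_pr pG derC hb hr Gz nCz ncz).
have eq : logn p #|G : <<commuter 0 z>>| = r z by rewrite eK (head_index p Gz).
have max u : u \in G -> u \notin C -> u \notin <<commuter 0 z>>%G -> r u <= r z.
  rewrite memK => Gu nCu nKu.
  apply: zmax; apply/and3P; split=> //; apply: contra nKu => /subsetP/(_ z Gz).
  by rewrite !commuterP // comm_memC.
have sub : commuter 0 z \subset <<commuter 0 z>>%G by rewrite KE.
have := greedy p_pr pG prC derC hb hr Gz nCz (sub_seq1 Gz) prK sub lift eq rm max.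
rewrite defect_head => h.
have st := leq_trans (defect_tail_cons p (sub_nil G) Gz) (leq_add (tail_le pG hb Gz nCz) (leqnn _)).
apply: leq_trans (leq_add (leqnn _) st) _.
rewrite addnCA; apply: leq_trans (leq_add (leqnn _) h) _.
rewrite addnA subnK // binS bin1 addnC leq_add2r.
have := bin2_add (m - r z) (leqnn (r z)); by rewrite subnKC.
Qed.
End Main.

(** * From avoided subgroups to the theorem *)

Section Cover.
Import GroupScope.
Variables (gT : finGroupType) (p : nat) (G : {group gT}) (m : nat).
Hypothesis (p_pr : prime p) (pG : p.-group G).

(** The center modulo the third term is proper, as otherwise nilpotency would kill the derived
    subgroup; so it can be avoided together with [Hs]. *)
Lemma avoids_noncentral (Hs : seq {group gT}) : 0 < defect p G [::] -> size Hs < p ->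
    all (fun H : {group gT} => H \proper G) Hs ->
  exists x, [/\ x \in G, avoids Hs x & ~~ (G \subset commuter G 0 x)].
Proof.
move=> D0 ltHp prHs.
have [Z ZE] := centralizer_mod (layer_norm (letters_layer 0 (sub_nil G))).
have ZG : Z \subset G by apply/subsetP=> z; rewrite ZE => /andP[].
have prZ : Z \proper G.
  rewrite properE ZG; apply: contraL D0 => GZ.
  have sub : 'L_2(G) \subset [~: 'L_2(G), G].
    rewrite -(lcnSn 1) {1}lcnSn gen_subG; apply/subsetP=> _ /imset2P[z h Gz Gh ->].
    by have := subsetP GZ z Gz; rewrite ZE => /andP[_ /forall_inP]; apply.
  have /implyP := forallP (pgroup_nil pG) ('L_2(G))%G.
  rewrite subsetI lcn_sub sub => /(_ isT)/eqP e1.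
  by rewrite (defect_nil pG) -lcn2 e1 cards1 logn1.
have [x Gx /andP[nZx ax]] : exists2 x, x \in G & avoids (Z :: Hs) x.
  by apply: (avoids_exists p_pr pG) => //=; rewrite prZ.
exists x; split=> //; apply: contra nZx => sub; rewrite ZE Gx.
by apply/forall_inP=> h Gh; rewrite -commuterP // (subsetP sub).
Qed.

Lemma defect_le_avoid (Hs : seq {group gT}) : size Hs < p ->
    all (fun H : {group gT} => H \proper G) Hs ->
    (forall y, y \in G -> avoids Hs y -> breadth p G y <= m) ->
  defect p G [::] <= 'C(m.+1, 2).
Proof.
move=> ltHp prHs hb; case: (posnP (defect p G [::])) => [-> //|D0].
have [p2|pn2] : p = 2 \/ p != 2 by case: (p =P 2); [left | right].
  (* For [p = 2] the list has at most one member; a maximal [C] containing it also contains the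
     derived subgroup. *)
  have [C maxC HC] : exists2 C : {group gT}, maximal C G &
      forall y, y \notin C -> avoids Hs y.
    case: Hs ltHp prHs {hb} => [|H [|H' Hs]] /=; rewrite p2 // => _.
      have pr1 : [1 gT]%G \proper G.
        rewrite proper1G; apply: contraL D0 => /eqP G1.
        rewrite (defect_nil pG) G1 (trivgP (der_sub _ _)) cards1 logn1 //.
      by have [C maxC _] := maximal_exists_sub pr1; exists C.
    rewrite andbT => prH; have [C maxC HC] := maximal_exists_sub prH.
    by exists C => // y; rewrite /avoids /= andbT; apply: contra; apply: (subsetP HC).
  have prC := maxgroupp maxC.
  have hbC y : y \in G -> y \notin C -> breadth p G y <= m.
    by move=> Gy /HC; apply: hb.
  have derC : 'L_2(G) \subset C.
    apply: subset_trans (Phi_sub_max maxC).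
    by rewrite (Phi_joing pG) joing_subl.
  have prCs : all (fun H : {group gT} => H \proper G) [:: C] by rewrite /= prC.
  have lt1 : size [:: C] < p by rewrite p2.
  have hbCs y : y \in G -> avoids [:: C] y -> breadth p G y <= m.
    by rewrite /avoids /= andbT; apply: hbC.
  rewrite leqNgt; apply/negP=> ltD; move: (ltD); rewrite ltnNge => /negP; apply.
  apply: (exact_defect_le p_pr pG prC derC hbC).
    (* A defect above the target attains the weaker bound of [first_step], which forces graded
       breadth at least [m]. *)
    move=> y Gy nCy ncy; have ay : avoids [:: C] y by rewrite /avoids /= nCy.
    have := leq_trans ltD (first_step p_pr pG lt1 hbCs Gy ay ncy).
    by rewrite p2 eqxx addn1 ltnS binS bin1 addnC leq_add2r.
  have [y [Gy ay ncy]] := avoids_noncentral D0 lt1 prCs.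
  by exists y => //; rewrite ncy andbT; move: ay; rewrite /avoids /= andbT.
have [x [Gx ax ncx]] := avoids_noncentral D0 ltHp prHs.
have := first_step p_pr pG ltHp hb Gx ax ncx.
rewrite (negbTE pn2) addn0 => /leq_trans; apply.
rewrite binS bin1 addnC leq_add2l; apply: leq_trans (hb x Gx ax).
exact: brank_le_breadth.
Qed.
End Cover.

Theorem theorem2p2 (p : nat) (gT : finGroupType) (G : {group gT}) (n : nat) :
  prime p -> (p.-group G)%g ->
  p ^ (n * (n - 1) %/ 2) < #|G^`(1)%g| ->
  ~ (exists H : 'I_p.-1 -> {group gT},
       (forall i, H i \proper G)%g /\
       (forall x, x \in G -> n <= breadth p G x -> exists i, x \in H i)).
Proof.
move=> p_pr pG ltG' [H [prH cover]].
pose Hs := [seq H i | i <- enum 'I_p.-1].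
have ltHs : size Hs < p by rewrite size_map size_enum_ord prednK // prime_gt0.
have prHs : all (fun H : {group gT} => H \proper G)%g Hs.
  by apply/allP=> _ /mapP[i _ ->].
have small x : x \in G -> avoids Hs x -> breadth p G x < n.
  move=> Gx /allP nx; rewrite ltnNge; apply/negP=> /(cover x Gx)[i Hx].
  by move: (nx (H i)); rewrite Hx map_f ?mem_enum // => /(_ isT).
(* For [n = 0] no element could avoid [Hs]; for [n = m.+1] breadth is at most [m] off [Hs], and
   ['C(m.+1, 2)] is the given exponent. *)
case: n small ltG' {cover} => [|m] small ltG'.
  by have [x Gx /(small x Gx)] := avoids_exists p_pr pG (ltnW ltHs) prHs.
have := defect_le_avoid p_pr pG ltHs prHs small.
rewrite (defect_nil pG) leqNgt => /negP; apply.
have [k oG'] := p_natP (pgroupS (der_sub 1 G) pG).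
move: ltG'; rewrite oG' pfactorK // ltn_exp2l ?prime_gt1 //.
by rewrite bin2 -divn2 subn1.
Qed.
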